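(* Let $d\ge1$, $\omega=(\omega_1,\dots,\omega_d)\in(0,\infty)^d$, $V^{harm}(x)=\frac12(\omega_1^2x_1^2+\dots+\omega_d^2x_d^2)$, $\gamma\in(-1,\infty)$ and $\lambda_N=N^{1-\gamma}$. Let $H_N$ be the operator on $\ell^2(\mathbb{Z}^d)$ $$H_Nf(x)=\frac{N^2}{2}\sum_{y\in\mathbb{Z}^d:\,|x-y|=1}\big(f(x)-f(y)\big)+N^{2(1-\gamma)}V^{harm}(x/N)f(x).$$ Then for every $n\in\mathbb{N}_0$, $$\lim_{N\to\infty}\frac{E_n(H_N)}{\lambda_N}=e_n(V^{harm}).$$
   Context: $E_n(H_N)$ denotes the $n$-th eigenvalue of the self-adjoint operator $H_N$ (which has purely discrete spectrum) counted with multiplicity, starting with $n=0$ for the ground state. $e_0(V^{harm})\le e_1(V^{harm})\le\dots$ is the non-decreasing enumeration, with multiplicity (one entry per multi-index), of the numbers $\frac12\sum_{i=1}^d\omega_i(2n_i+1)$, $n_1,\dots,n_d\in\mathbb{N}_0$. *)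

(* Defs.v *)
From HB Require Import structures.
From mathcomp Require Import all_boot all_order all_algebra.
From mathcomp Require Import all_classical all_reals all_analysis.
Set Implicit Arguments. Unset Strict Implicit. Unset Printing Implicit Defensive.
Import Order.TTheory GRing.Theory Num.Theory.
Local Open Scope ring_scope.
Local Open Scope classical_set_scope.

Definition site (d : nat) := {ffun 'I_d -> int}.

Definition shift (d : nat) (x : site d) (i : 'I_d) (s : int) : site d :=
  [ffun j => if j == i then x j + s else x j].

Definition nbsum (R : realType) (d : nat) (f : site d -> R) (x : site d) : R :=
  \sum_(i < d) ((f x - f (shift x i 1)) + (f x - f (shift x i (-1)))).

Definition Vharm (R : realType) (d : nat) (omega : 'I_d -> R) (y : 'I_d -> R) : R :=
  2^-1 * \sum_(i < d) (omega i ^+ 2 * y i ^+ 2).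

Definition HN (R : realType) (d : nat) (omega : 'I_d -> R) (gamma : R) (N : nat)
  (f : site d -> R) (x : site d) : R :=
  (N%:R ^+ 2 / 2) * nbsum f x
  + powR N%:R (2 * (1 - gamma)) * Vharm omega (fun i => (x i)%:~R / N%:R) * f x.

Definition is_l2 (R : realType) (d : nat) (f : site d -> R) : Prop :=
  (\esum_(x in [set: site d]) ((f x ^+ 2)%:E) < +oo)%E.

Definition is_eigfun (R : realType) (d : nat)
  (H : (site d -> R) -> site d -> R) (E : R) (f : site d -> R) : Prop :=
  [/\ is_l2 f, exists x, f x != 0 & forall x, H f x = E * f x].

Definition linindep (R : realType) (d m : nat) (g : 'I_m -> site d -> R) : Prop :=
  forall c : 'I_m -> R, (forall x, \sum_(k < m) c k * g k x = 0) -> forall k, c k = 0.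

(* E_n(H): the n-th eigenvalue counted with multiplicity (n = 0 ground state),
   i.e. the least E such that there are at least n+1 eigenvalues <= E counted
   with multiplicity, i.e. n+1 linearly independent l^2 eigenfunctions whose
   eigenvalues are <= E. *)
Definition Eval (R : realType) (d : nat) (H : (site d -> R) -> site d -> R) (n : nat) : R :=
  inf [set E : R | exists (g : 'I_n.+1 -> site d -> R) (mu : 'I_n.+1 -> R),
         (forall k, is_eigfun H (mu k) (g k) /\ mu k <= E) /\ linindep g].

Definition harm_level (R : realType) (d : nat) (omega : 'I_d -> R)
  (m : {ffun 'I_d -> nat}) : R :=
  2^-1 * \sum_(i < d) (omega i * (2 * (m i)%:R + 1)).

(* e_n(V^harm): non-decreasing enumeration with multiplicity (one entry per
   multi-index) of the harmonic levels: least E such that at least n+1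
   distinct multi-indices have level <= E. *)
Definition e_harm (R : realType) (d : nat) (omega : 'I_d -> R) (n : nat) : R :=
  inf [set E : R | exists m : 'I_n.+1 -> {ffun 'I_d -> nat},
         injective m /\ forall k, harm_level omega (m k) <= E].

(* Main.v *)
(* Write L = N^(1+gamma). Then H_N / N^(1-gamma) is the discretized oscillator A
   with hopping L/2 and potential sum_i omega_i^2 x_i^2 / (2L), and L -> oo.
   A is compared with an exactly solvable operator K: in direction i, with
   s_i = floor(L/omega_i), K is omega_i (s_i + 1/2 - J), where J is the spin-s_i
   matrix S_x acting on {-s_i, ..., s_i}. Its eigenvectors are the normalized
   Kravchuk polynomials, i.e. the coefficients of (1+X)^(2s-j) (1-X)^j, and its
   eigenvalues are exactly the harmonic levels of the multi-indices m with
   m_i <= 2 s_i. On the region |x| <= rho, with rho a small multiple of L, the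
   forms of A and K agree up to a factor 1 + eps and an additive eps,
   while low-energy functions of A and of K live at distance sqrt L << rho, so
   that multiplication by a tent function of radius rho transports low-energy
   subspaces in both directions at small cost. Eigenfunctions of A are produced
   by successive minimization; minimizing sequences converge pointwise along an
   ultrafilter, and no mass is lost because the potential is proper. *)
From HB Require Import structures.
From mathcomp Require Import all_boot all_order all_algebra.
From mathcomp Require Import all_classical all_reals all_analysis.
From mathcomp Require Import ring lra zify.
Require Import Defs.
Import Order.TTheory GRing.Theory Num.Theory numFieldNormedType.Exports.
Local Open Scope ring_scope.
Local Open Scope classical_set_scope.
Set Implicit Arguments.
Unset Strict Implicit.
Unset Printing Implicit Defensive.

(** * Unconditional sums of real families *)

(** [Eval] is an infimum over finite families of genuine l^2 eigenfunctions, so the two bounds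
    differ in nature. The lower bound treats a given family: counting dimensions yields a nonzero
    combination orthogonal to at most n cut-off Kravchuk functions. The upper bound must produce
    eigenfunctions, since the infimum of an empty set would carry no information; no spectral
    theorem is invoked, hence the minimization. Comparison with K replaces a continuum limit: no
    Hermite function is discretized and no convergence of eigenfunctions is shown, because K lives
    on the same lattice and already has the limiting levels. The size of the spins is forced by
    matching both terms near the origin: [omega * sqrt (s^2 - z^2) / 2 ~ L / 2] and [omega * (s -
    sqrt (s^2 - z^2)) ~ omega^2 z^2 / (2 L)]. A cut-off is needed because the hopping of K vanishes
    at the edge of its box while that of A is constant. A tent of slope 1/rho costs an energy of
    order [L / rho^2], hence of order 1/L when rho is proportional to L. *)

Section Summation.
Variables (R : realType) (T : choiceType).
Implicit Types (F G H : T -> R) (M c : R).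

Definition l1 F : Prop := (\esum_(x in [set: T]) `|F x|%:E < +oo)%E.

(* Any decomposition of F as a difference of nonnegative summable functions
   would do; this one is bounded by 2|F|. *)
Definition Sum F : R :=
  fine (\esum_(x in [set: T]) `|F x|%:E)%E
  - fine (\esum_(x in [set: T]) (`|F x| - F x)%:E)%E.

Lemma l1_le F G : (forall x, `|F x| <= G x) -> l1 G -> l1 F.
Proof.
move=> FG; apply: le_lt_trans; apply: le_esum => x _; rewrite lee_fin.
exact: le_trans (FG x) (ler_norm _).
Qed.

Lemma l1D F G : l1 F -> l1 G -> l1 (fun x => F x + G x).
Proof.
move=> lF lG; have := lte_add_pinfty lF lG.
apply: le_lt_trans; rewrite -esumD //; [|by move=> *; rewrite lee_fin..].
by apply: le_esum => x _; rewrite -EFinD lee_fin ler_normD.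
Qed.

Lemma l1_norm F : l1 F -> l1 (fun x => `|F x|).
Proof.
move=> lF; rewrite /l1 (@eq_esum _ _ _ _ (fun x => `|F x|%:E)) // => x _.
by rewrite normr_id.
Qed.

Lemma l1N F : l1 F -> l1 (fun x => - F x).
Proof. by move=> lF; apply: (l1_le _ (l1_norm lF)) => x; rewrite normrN. Qed.

Lemma l1B F G : l1 F -> l1 G -> l1 (fun x => F x - G x).
Proof. by move=> lF /l1N; apply: l1D. Qed.

Lemma l10 : l1 (fun=> 0).
Proof. by rewrite /l1 esum1 // => x _; rewrite normr0. Qed.

Lemma l1_nat_mul F n : l1 F -> l1 (fun x => F x *+ n).
Proof.
move=> lF; elim: n => [|n ihn]; first exact: l10.
by under eq_fun do rewrite mulrS; apply: l1D.
Qed.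

Lemma l1Z c F : l1 F -> l1 (fun x => c * F x).
Proof.
(* Integer multiples are reached by additivity alone, and some integer exceeds [|c|]. *)
move=> lF; apply: (l1_le _ (l1_nat_mul (Num.bound `|c|) (l1_norm lF))) => x.
rewrite normrM -[leRHS]mulr_natl ler_wpM2r //; exact/ltW/archi_boundP.
Qed.

Lemma l1_sum (I : Type) (r : seq I) (P : pred I) (f : I -> T -> R) :
  (forall i, P i -> l1 (f i)) -> l1 (fun x => \sum_(i <- r | P i) f i x).
Proof.
move=> lf; elim: r => [|i r ihr].
  by under eq_fun do rewrite big_nil; exact: l10.
under eq_fun do rewrite big_cons.
by case Pi : (P i) => //; exact: l1D (lf _ Pi) ihr.
Qed.

Lemma l1_ge0_fin F : (forall x, 0 <= F x) -> l1 F ->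
  (\esum_(x in [set: T]) (F x)%:E)%E \is a fin_num.
Proof.
move=> F0 lF; rewrite ge0_fin_numE; last by apply: esum_ge0 => x _; rewrite lee_fin.
apply: le_lt_trans lF; apply: le_esum => x _; rewrite lee_fin; exact: ler_norm.
Qed.

Let nsum F := fine (\esum_(x in [set: T]) (F x)%:E)%E.

Let nsumD F G : (forall x, 0 <= F x) -> (forall x, 0 <= G x) -> l1 F -> l1 G ->
  nsum (fun x => F x + G x) = nsum F + nsum G.
Proof.
move=> F0 G0 lF lG; rewrite /nsum; under eq_esum do rewrite EFinD.
by rewrite esumD ?fineD ?l1_ge0_fin // => x _; rewrite lee_fin.
Qed.

Let normB_ge0 F x : 0 <= `|F x| - F x.
Proof. by rewrite subr_ge0 ler_norm. Qed.

(** Independence of the decomposition: two decompositions of one function into nonnegative parts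
    agree after crosswise addition. Linearity of [Sum] rests on this. *)
Let Sum_diff G H : (forall x, 0 <= G x) -> (forall x, 0 <= H x) -> l1 G -> l1 H ->
  Sum (fun x => G x - H x) = nsum G - nsum H.
Proof.
move=> G0 H0 lG lH; have lGH := l1B lG lH; have lGHn := l1_norm lGH.
have e : nsum (fun x => `|G x - H x| - (G x - H x)) + nsum G =
    nsum (fun x => `|G x - H x|) + nsum H.
  rewrite -!nsumD //; first by congr nsum; apply/funext => x; ring.
    by move=> x; rewrite subr_ge0 ler_norm.
  exact: l1B.
by rewrite /Sum -/(nsum (fun x => `|G x - H x|))
  -/(nsum (fun x => `|G x - H x| - (G x - H x))); move: e; lra.
Qed.

Lemma SumE F : (forall x, 0 <= F x) -> Sum F = fine (\esum_(x in [set: T]) (F x)%:E)%E.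
Proof.
move=> F0; rewrite /Sum (@esum1 _ _ _ (fun x => (`|F x| - F x)%:E)) ?subr0.
  by under eq_esum do rewrite ger0_norm //.
by move=> x _; rewrite ger0_norm ?subrr.
Qed.

Lemma SumD F G : l1 F -> l1 G -> Sum (fun x => F x + G x) = Sum F + Sum G.
Proof.
move=> lF lG; have lFn := l1_norm lF; have lGn := l1_norm lG.
have -> : (fun x => F x + G x) =
    (fun x => (`|F x| + `|G x|) - ((`|F x| - F x) + (`|G x| - G x))).
  by apply/funext => x; ring.
have lFm := l1B lFn lF; have lGm := l1B lGn lG.
rewrite Sum_diff; [|by move=> x; rewrite addr_ge0|by move=> x; rewrite addr_ge0
  |exact: l1D|exact: l1D].
rewrite (nsumD _ _ lFn lGn) // (nsumD _ _ lFm lGm) //.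
rewrite /Sum /nsum; ring.
Qed.

Lemma eq_Sum F G : F =1 G -> Sum F = Sum G.
Proof. by move/funext => ->. Qed.

Lemma Sum0 : Sum (fun=> 0) = 0.
Proof. by rewrite SumE // esum1. Qed.

Lemma SumN F : l1 F -> Sum (fun x => - F x) = - Sum F.
Proof.
move=> lF; apply/eqP; rewrite -addr_eq0 -SumD //; last exact: l1N.
by under eq_fun do rewrite addNr; rewrite Sum0.
Qed.

Lemma SumB F G : l1 F -> l1 G -> Sum (fun x => F x - G x) = Sum F - Sum G.
Proof. by move=> lF lG; rewrite SumD ?SumN //; exact: l1N. Qed.

Lemma Sum_ge0 F : (forall x, 0 <= F x) -> 0 <= Sum F.
Proof. by move=> F0; rewrite SumE // fine_ge0 // esum_ge0 // => x _; rewrite lee_fin. Qed.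

Lemma Sum_le F G : l1 F -> l1 G -> (forall x, F x <= G x) -> Sum F <= Sum G.
Proof.
move=> lF lG FG; rewrite -subr_ge0 -SumB //.
by apply: Sum_ge0 => x; rewrite subr_ge0.
Qed.

Lemma Sum_sum (I : Type) (r : seq I) (P : pred I) (f : I -> T -> R) :
  (forall i, P i -> l1 (f i)) ->
  Sum (fun x => \sum_(i <- r | P i) f i x) = \sum_(i <- r | P i) Sum (f i).
Proof.
move=> lf; elim: r => [|i r ihr].
  by under eq_fun do rewrite big_nil; rewrite big_nil Sum0.
rewrite big_cons; under eq_fun do rewrite big_cons.
by case Pi : (P i) => //; rewrite SumD ?ihr //; [exact: lf|exact: l1_sum].
Qed.

Lemma Sum_uniq_ge F (s : seq T) : uniq s -> (forall x, 0 <= F x) -> l1 F ->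
  \sum_(x <- s) F x <= Sum F.
Proof.
move=> us F0 lF; rewrite SumE // -lee_fin fineK ?l1_ge0_fin //.
apply: esum_ge; exists [set` s]; first by split => //; exact: finite_seq.
by rewrite -fsbig_seq // sumEFin.
Qed.

Lemma Sum_uniq_le F M : (forall x, 0 <= F x) ->
  (forall s : seq T, uniq s -> \sum_(x <- s) F x <= M) -> l1 F /\ Sum F <= M.
Proof.
move=> F0 FM.
have leM : (\esum_(x in [set: T]) (F x)%:E <= M%:E)%E.
  apply: ge_ereal_sup => _ [A [finA _] <-].
  by rewrite fsbig_finite //= sumEFin lee_fin FM.
have lF : l1 F.
  rewrite /l1; under eq_esum do rewrite ger0_norm //.
  exact: le_lt_trans leM (ltry _).
by split=> //; rewrite SumE // -lee_fin fineK // l1_ge0_fin.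
Qed.

Lemma Sum_ge_single F x : (forall x, 0 <= F x) -> l1 F -> F x <= Sum F.
Proof.
by move=> F0 lF; have := @Sum_uniq_ge F [:: x] isT F0 lF; rewrite big_seq1.
Qed.

Let SumZ_le c F : 0 <= c -> (forall x, 0 <= F x) -> l1 F ->
  Sum (fun x => c * F x) <= c * Sum F.
Proof.
move=> c0 F0 lF; apply: (proj2 (Sum_uniq_le _ _)) => [x|s us].
  by rewrite mulr_ge0.
by rewrite -mulr_sumr ler_wpM2l // Sum_uniq_ge.
Qed.

Let SumZ_ge0 c F : 0 <= c -> (forall x, 0 <= F x) -> l1 F ->
  Sum (fun x => c * F x) = c * Sum F.
Proof.
move=> c0 F0 lF; have [->|c_neq0] := eqVneq c 0.
  by under eq_fun do rewrite mul0r; rewrite mul0r Sum0.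
have c_gt0 : 0 < c by rewrite lt_neqAle eq_sym c_neq0.
apply/eqP; rewrite eq_le SumZ_le //= -ler_pdivlMl //.
(* The reverse inequality is [SumZ_le] with factor [c^-1], applied to [c * F]. *)
have {1}-> : F = (fun x => c^-1 * (c * F x)).
  by apply/funext => x; rewrite mulKf.
apply: SumZ_le; [by rewrite invr_ge0|by move=> x; rewrite mulr_ge0|exact: l1Z].
Qed.

Lemma SumZ c F : l1 F -> Sum (fun x => c * F x) = c * Sum F.
Proof.
move=> lF; have lFn := l1_norm lF; have lFm := l1B lFn lF.
wlog c0 : c / 0 <= c => [hw|].
  have [|c0] := lerP 0 c; first exact: hw.
  have -> : (fun x => c * F x) = (fun x => - (- c * F x)).
    by apply/funext => x; rewrite mulNr opprK.
  by rewrite SumN ?hw ?mulNr ?opprK ?oppr_ge0 ?ltW //; exact: l1Z.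
have {1}-> : F = (fun x => `|F x| - (`|F x| - F x)).
  by apply/funext => x; ring.
have -> : Sum F = Sum (fun x => `|F x|) - Sum (fun x => `|F x| - F x).
  by rewrite SumB //; ring.
under eq_fun do rewrite mulrBr.
by rewrite SumB ?SumZ_ge0 ?mulrBr //; exact: l1Z.
Qed.
End Summation.

Lemma l1_bij (R : realType) (T T' : choiceType) (e : T -> T') (F : T' -> R) :
  bijective e -> l1 F -> l1 (F \o e).
Proof.
move=> be; rewrite /l1 (reindex_esum setT setT e) //.
by case: be => f fK eK; split => // [x y _ _ /(can_inj fK)|y _] //; exists (f y).
Qed.

Lemma Sum_bij (R : realType) (T T' : choiceType) (e : T -> T') (F : T' -> R) :
  bijective e -> Sum (F \o e) = Sum F.
Proof.
move=> be; have sbe : set_bij setT setT e.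
  by case: be => f fK eK; split => // [x y _ _ /(can_inj fK)|y _] //; exists (f y).
by rewrite /Sum [in RHS](reindex_esum setT setT e) //
  [X in _ = _ - fine X](reindex_esum setT setT e).
Qed.

Section FiniteSupport.
Variables (R : realType) (T : choiceType) (I : finType) (e : I -> T).
Hypothesis e_inj : injective e.

Let esum_finite (F : T -> R) : (forall x, 0 <= F x) ->
  (forall x, F x != 0 -> exists i, e i = x) ->
  (\esum_(x in [set: T]) (F x)%:E = (\sum_i F (e i))%:E)%E.
Proof.
move=> F0 supF.
have -> : (\esum_(x in [set: T]) (F x)%:E = \esum_(x in e @` setT) (F x)%:E)%E.
  rewrite [RHS]esum_mkcond; apply: eq_esum => x _.
  case: ifPn => //; rewrite notin_setE /= => nx.
  have [->//|/supF[i ix]] := eqVneq (F x) 0.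
  by case: nx; exists i.
rewrite esum_image; last by move=> x y _ _; exact: e_inj.
rewrite esum_fset; [|exact: finite_finset|by move=> i _; rewrite lee_fin].
rewrite (fsbigE (index_enum I)) ?index_enum_uniq //; last first.
  by move=> i _; rewrite mem_index_enum.
by rewrite -sumEFin; apply: eq_bigl => i; rewrite in_setT.
Qed.

Lemma l1_finite (F : T -> R) : (forall x, F x != 0 -> exists i, e i = x) -> l1 F.
Proof.
move=> supF; rewrite /l1 esum_finite ?ltry // => x.
by rewrite normr_eq0; exact: supF.
Qed.

Lemma Sum_finite (F : T -> R) : (forall x, F x != 0 -> exists i, e i = x) ->
  Sum F = \sum_i F (e i).
Proof.
move=> supF; rewrite /Sum !esum_finite //=.
- by rewrite -sumrB; apply: eq_bigr => i _; ring.
- by move=> x; rewrite subr_ge0 ler_norm.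
- move=> x Fx; apply: supF; apply: contra Fx => /eqP ->.
  by rewrite normr0 subrr.
- by move=> x; rewrite normr_eq0; exact: supF.
Qed.
End FiniteSupport.

(** * Lattice quadratic forms *)

Section SquareSummable.
Variables (R : realType) (T : choiceType).
Implicit Types (f g h : T -> R).

Definition l2 f : Prop := l1 (fun x => f x ^+ 2).
Definition ip f g : R := Sum (fun x => f x * g x).

Lemma l2_mul f g : l2 f -> l2 g -> l1 (fun x => f x * g x).
Proof.
move=> lf lg; apply: (l1_le _ (l1D lf lg)) => x.
have := sqr_ge0 (f x - g x); have := sqr_ge0 (f x + g x).
by rewrite ler_norml => ? ?; apply/andP; split; lra.
Qed.

Lemma l2_le f g : (forall x, `|f x| <= `|g x|) -> l2 g -> l2 f.
Proof.
move=> fg; apply: l1_le => x; rewrite ger0_norm ?sqr_ge0 //.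
by rewrite -(real_normK (num_real (f x))) -(real_normK (num_real (g x))) lerXn2r ?nnegrE.
Qed.

Lemma l2D f g : l2 f -> l2 g -> l2 (fun x => f x + g x).
Proof.
move=> lf lg; apply: (l1_le _ (l1Z 2 (l1D lf lg))) => x.
by rewrite ger0_norm ?sqr_ge0 //; have := sqr_ge0 (f x - g x); lra.
Qed.

Lemma l2Z c f : l2 f -> l2 (fun x => c * f x).
Proof.
move=> lf; apply: (l1_le _ (l1Z (c ^+ 2) lf)) => x.
by rewrite exprMn ger0_norm // mulr_ge0 ?sqr_ge0.
Qed.

Lemma l2B f g : l2 f -> l2 g -> l2 (fun x => f x - g x).
Proof.
move=> lf lg; apply: (l1_le _ (l1Z 2 (l1D lf lg))) => x.
by rewrite ger0_norm ?sqr_ge0 //; have := sqr_ge0 (f x + g x); lra.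
Qed.

Lemma l2_bounded_mul (a : T -> R) (C : R) f :
  (forall x, `|a x| <= C) -> l2 f -> l2 (fun x => a x * f x).
Proof.
move=> aC lf; apply: (l2_le _ (l2Z C lf)) => x.
by rewrite !normrM ler_wpM2r // (le_trans (aC x)) // ler_norm.
Qed.

Lemma l2_bij (e : T -> T) f : bijective e -> l2 f -> l2 (fun x => f (e x)).
Proof. by move=> be; exact: (@l1_bij _ _ _ e (fun x => f x ^+ 2) be). Qed.

Lemma l20 : l2 (fun=> 0 : R).
Proof. by rewrite /l2; under eq_fun do rewrite expr0n /=; exact: l10. Qed.

Lemma l2_sum (I : Type) (r : seq I) (P : pred I) (f : I -> T -> R) :
  (forall i, P i -> l2 (f i)) -> l2 (fun x => \sum_(i <- r | P i) f i x).
Proof.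
move=> lf; elim: r => [|i r ihr].
  by under eq_fun do rewrite big_nil; exact: l20.
under eq_fun do rewrite big_cons.
by case Pi : (P i) => //; exact: l2D (lf _ Pi) ihr.
Qed.

Lemma ipC f g : ip f g = ip g f.
Proof. by rewrite /ip; under eq_fun do rewrite mulrC. Qed.

Lemma ip_ge0 f : 0 <= ip f f.
Proof. by apply: Sum_ge0 => x; rewrite -expr2 sqr_ge0. Qed.

Lemma ip_ge_sqr f x : l2 f -> f x ^+ 2 <= ip f f.
Proof.
move=> lf; rewrite expr2 /ip.
by apply: (@Sum_ge_single _ _ (fun x => f x * f x)) => [y|]; [rewrite -expr2 sqr_ge0|exact: l2_mul].
Qed.

Lemma ip_gt0 f x : l2 f -> f x != 0 -> 0 < ip f f.
Proof.
by move=> lf fx; apply: lt_le_trans (ip_ge_sqr x lf); rewrite exprn_even_gt0.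
Qed.

Lemma ip_suml (I : Type) (r : seq I) (c : I -> R) (g : I -> T -> R) h :
  (forall i, l2 (g i)) -> l2 h ->
  ip (fun x => \sum_(i <- r) c i * g i x) h = \sum_(i <- r) c i * ip (g i) h.
Proof.
move=> lg lh; rewrite /ip; under eq_fun do rewrite mulr_suml.
rewrite Sum_sum; last first.
  by move=> i _; under eq_fun do rewrite -mulrA; apply/l1Z/l2_mul.
apply: eq_bigr => i _; under eq_fun do rewrite -mulrA.
by rewrite SumZ //; exact: l2_mul.
Qed.

Lemma ip_sumr (I : Type) (r : seq I) (c : I -> R) (g : I -> T -> R) h :
  (forall i, l2 (g i)) -> l2 h ->
  ip h (fun x => \sum_(i <- r) c i * g i x) = \sum_(i <- r) c i * ip h (g i).
Proof.
by move=> lg lh; rewrite ipC ip_suml //; apply: eq_bigr => i _; rewrite ipC.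
Qed.

Definition delta (x0 : T) (x : T) : R := (x == x0)%:R.

Lemma l2_delta x0 : l2 (delta x0).
Proof.
apply: (@l1_finite _ _ unit (fun=> x0)) => [[] [] //|x].
by rewrite /delta /=; case: (x =P x0) => [->|_]; [exists tt|rewrite mulr0n expr0n eqxx].
Qed.

Lemma Sum_delta f x0 : Sum (fun x => f x * delta x0 x) = f x0.
Proof.
rewrite (@Sum_finite _ _ unit (fun=> x0)) => [|[] []//|x].
  by rewrite big_const card_unit /= /delta eqxx mulr1 addr0.
by rewrite /delta /=; case: (x =P x0) => [->|_]; [exists tt|rewrite mulr0n mulr0 eqxx].
Qed.
End SquareSummable.

Section QuadraticForm.
Variables (R : realType) (d : nat).
Notation T := (site d).
Implicit Types (f g h : T -> R) (x : T).

Lemma shiftK (i : 'I_d) : cancel (fun x : T => shift x i 1) (fun x => shift x i (-1)).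
Proof. by move=> x; apply/ffunP => j; rewrite !ffunE; case: eqP => // _; rewrite addrK. Qed.

Lemma shiftNK (i : 'I_d) : cancel (fun x : T => shift x i (-1)) (fun x => shift x i 1).
Proof. by move=> x; apply/ffunP => j; rewrite !ffunE; case: eqP => // _; rewrite subrK. Qed.

Lemma shift_bij (i : 'I_d) : bijective (fun x : T => shift x i 1).
Proof. exact: Bijective (shiftK i) (shiftNK i). Qed.

Lemma shiftN_bij (i : 'I_d) : bijective (fun x : T => shift x i (-1)).
Proof. exact: Bijective (shiftNK i) (shiftK i). Qed.

Variables (a : 'I_d -> T -> R) (W : T -> R) (C : R).
Hypothesis a_ge0 : forall i x, 0 <= a i x.
Hypothesis a_le : forall i x, a i x <= C.
Hypothesis W_ge0 : forall x, 0 <= W x.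

(** Each undirected edge is counted once, at its lower endpoint. *)
Definition edens f g x : R :=
  \sum_i a i x * ((f (shift x i 1) - f x) * (g (shift x i 1) - g x)) + W x * (f x * g x).
Definition form f g : R := Sum (edens f g).
Definition fdom f : Prop := l2 f /\ l1 (fun x => W x * f x ^+ 2).

(* The edge weight a i x is carried by {x, x + e_i}. *)
Definition fop f x : R :=
  \sum_i (a i x * (f x - f (shift x i 1)) +
          a i (shift x i (-1)) * (f x - f (shift x i (-1)))) + W x * f x.

Let l2_grad i f : l2 f -> l2 (fun x => a i x * (f (shift x i 1) - f x)).
Proof.
move=> lf; apply: (@l2_bounded_mul _ _ _ C) => [x|]; first by rewrite ger0_norm.
by apply: l2B => //; exact: l2_bij (shift_bij i) lf.
Qed.

Lemma fdom_mulW f g : fdom f -> fdom g -> l1 (fun x => W x * (f x * g x)).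
Proof.
move=> [_ lf] [_ lg]; apply: (l1_le _ (l1D lf lg)) => x.
rewrite normrM (ger0_norm (W_ge0 x)) -[leRHS]mulrDr ler_wpM2l //.
have := sqr_ge0 (f x - g x); have := sqr_ge0 (f x + g x).
by rewrite ler_norml => ? ?; apply/andP; split; lra.
Qed.

Lemma l1_edens f g : fdom f -> fdom g -> l1 (edens f g).
Proof.
move=> df dg; apply: l1D; last exact: fdom_mulW.
apply: l1_sum => i _; under eq_fun do rewrite mulrA.
apply: l2_mul; first by apply: l2_grad; case: df.
by apply: l2B; [apply: l2_bij (shift_bij i) _; case: dg|case: dg].
Qed.

Lemma fdomD f g : fdom f -> fdom g -> fdom (fun x => f x + g x).
Proof.
move=> [lf Wf] [lg Wg]; split; first exact: l2D.
apply: (l1_le _ (l1Z 2 (l1D Wf Wg))) => x.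
rewrite ger0_norm; last by rewrite mulr_ge0 // sqr_ge0.
rewrite -[X in 2 * X]mulrDr [leRHS]mulrCA ler_wpM2l //.
by have := sqr_ge0 (f x - g x); lra.
Qed.

Lemma fdomZ c f : fdom f -> fdom (fun x => c * f x).
Proof.
move=> [lf Wf]; split; first exact: l2Z.
by under eq_fun do rewrite exprMn mulrCA; exact: l1Z.
Qed.

Lemma fdom_sum (I : Type) (r : seq I) (c : I -> R) (g : I -> T -> R) :
  (forall i, fdom (g i)) -> fdom (fun x => \sum_(i <- r) c i * g i x).
Proof.
move=> dg; elim: r => [|i r ihr].
  under eq_fun do rewrite big_nil.
  split; first exact: l20.
  by under eq_fun do rewrite expr0n /= mulr0; exact: l10.
by under eq_fun do rewrite big_cons; apply: fdomD => //; exact: fdomZ.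
Qed.

Lemma fdom_delta x0 : fdom (delta R x0).
Proof.
split; first exact: l2_delta.
apply: (@l1_finite _ _ unit (fun=> x0)) => [[] [] //|x].
by rewrite /delta /=; case: (x =P x0) => [->|_]; [exists tt|rewrite mulr0n expr0n mulr0 eqxx].
Qed.

Lemma edensC f g : edens f g = edens g f.
Proof.
apply/funext => x; rewrite /edens [f x * _]mulrC; congr (_ + _).
by apply: eq_bigr => i _; rewrite [_ * (g _ - _)]mulrC.
Qed.

Lemma formC f g : form f g = form g f.
Proof. by rewrite /form edensC. Qed.

Lemma edens_ge0 f x : 0 <= edens f f x.
Proof.
by apply: addr_ge0; [apply: sumr_ge0 => i _|]; rewrite -expr2 mulr_ge0 ?sqr_ge0.
Qed.

Lemma form_ge0 f : 0 <= form f f.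
Proof. by apply: Sum_ge0 => x; exact: edens_ge0. Qed.

Lemma edens_geW f x : W x * f x ^+ 2 <= edens f f x.
Proof.
rewrite /edens -expr2 lerDr; apply: sumr_ge0 => i _.
by rewrite -expr2 mulr_ge0 ?sqr_ge0.
Qed.

Lemma form_geW f : fdom f -> Sum (fun x => W x * f x ^+ 2) <= form f f.
Proof.
by move=> df; apply: Sum_le; [case: df|exact: l1_edens|exact: edens_geW].
Qed.

Lemma edens_suml (I : Type) (r : seq I) (c : I -> R) (g : I -> T -> R) h x :
  edens (fun x => \sum_(i <- r) c i * g i x) h x = \sum_(i <- r) c i * edens (g i) h x.
Proof.
elim: r => [|k r ihr].
  rewrite /edens !big_nil mul0r mulr0 addr0 big1 // => i _.
  by rewrite !big_nil subrr mul0r mulr0.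
rewrite big_cons -ihr /edens big_cons [c k * (_ + _)]mulrDr mulr_sumr addrACA -big_split /=.
congr (_ + _); last by ring.
by apply: eq_bigr => i _; rewrite !big_cons; ring.
Qed.

Lemma form_suml (I : Type) (r : seq I) (c : I -> R) (g : I -> T -> R) h :
  (forall i, fdom (g i)) -> fdom h ->
  form (fun x => \sum_(i <- r) c i * g i x) h = \sum_(i <- r) c i * form (g i) h.
Proof.
move=> dg dh; rewrite /form (_ : edens _ h = fun x => \sum_(i <- r) c i * edens (g i) h x);
  last by apply/funext => x; rewrite edens_suml.
rewrite Sum_sum; last by move=> i _; apply/l1Z/l1_edens.
by apply: eq_bigr => i _; rewrite SumZ //; exact: l1_edens.
Qed.

Lemma form_sumr (I : Type) (r : seq I) (c : I -> R) (g : I -> T -> R) h :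
  (forall i, fdom (g i)) -> fdom h ->
  form h (fun x => \sum_(i <- r) c i * g i x) = \sum_(i <- r) c i * form h (g i).
Proof.
by move=> dg dh; rewrite formC form_suml //; apply: eq_bigr => i _; rewrite formC.
Qed.

(** Summation by parts: the translation by -e_i turns [P i], which carries g at the upper endpoint,
    into [P' i], which carries g at x. Bounded weights make every series involved absolutely
    convergent. *)
Lemma form_green f g : fdom f -> fdom g -> form f g = Sum (fun x => fop f x * g x).
Proof.
move=> df dg; have [[lf _] [lg _]] := (df, dg).
pose P i x := a i x * (f (shift x i 1) - f x) * g (shift x i 1).
pose P' i x := P i (shift x i (-1)).
pose Q i x := a i x * (f (shift x i 1) - f x) * g x.
have lP i : l1 (P i) by apply: l2_mul; [exact: l2_grad|exact: l2_bij (shift_bij i) lg].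
have lP' i : l1 (P' i) by exact: l1_bij (shiftN_bij i) (lP i).
have lQ i : l1 (Q i) by apply: l2_mul; [exact: l2_grad|].
have lW := fdom_mulW df dg.
have -> : form f g = Sum (fun x => \sum_i (P i x - Q i x) + W x * (f x * g x)).
  congr Sum; apply/funext => x; congr (_ + _); apply: eq_bigr => i _.
  by rewrite /P /Q; ring.
have -> : (fun x => fop f x * g x) =
    (fun x => \sum_i (P' i x - Q i x) + W x * (f x * g x)).
  apply/funext => x; rewrite /fop mulrDl -mulrA mulr_suml; congr (_ + _).
  by apply: eq_bigr => i _; rewrite /P' /P /Q shiftNK; ring.
rewrite !SumD ?Sum_sum //; try by [move=> i _; apply: l1B|apply: l1_sum => i _; apply: l1B].
congr (_ + _); apply: eq_bigr => i _; rewrite !SumB //; congr (_ - _).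
by rewrite -(Sum_bij (P i) (shiftN_bij i)).
Qed.

Lemma form_delta f x : fdom f -> form f (delta R x) = fop f x.
Proof. by move=> df; rewrite form_green ?Sum_delta //; exact: fdom_delta. Qed.

Definition weak_eigfun (mu : R) f : Prop :=
  fdom f /\ forall h, fdom h -> form f h = mu * ip f h.

Lemma weak_eigfun_fop mu f : weak_eigfun mu f -> forall x, fop f x = mu * f x.
Proof.
move=> [df wf] x; rewrite -form_delta // wf; last exact: fdom_delta.
by rewrite /ip Sum_delta.
Qed.

(** An l^2 solution lies in the form domain automatically: the equation expresses [W * f] through
    [mu * f] and the hopping terms, which are l^2 because the weights are bounded. *)
Lemma fop_weak_eigfun mu f : l2 f -> (forall x, fop f x = mu * f x) ->
  weak_eigfun mu f.
Proof.
move=> lf ef.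
have lWf : l2 (fun x => W x * f x).
  have -> : (fun x => W x * f x) = (fun x => mu * f x -
     \sum_i ((a i (shift x i (-1)) * (f x - f (shift x i (-1)))
              - a i x * (f (shift x i 1) - f x)))).
    apply/funext => x; rewrite -ef /fop.
    rewrite [_ + W x * _]addrC -addrA -sumrB big1 ?addr0 // => i _.
    by ring.
  apply: l2B; first exact: l2Z.
  apply: l2_sum => i _; apply: l2B; last exact: l2_grad.
  have := l2_bij (shiftN_bij i) (l2_grad i lf).
  by under eq_fun do rewrite shiftNK.
have df : fdom f.
  split => //; have -> : (fun x => W x * f x ^+ 2) = (fun x => W x * f x * f x).
    by apply/funext => x; rewrite expr2 mulrA.
  exact: l2_mul.
split=> // h dh; rewrite form_green // /ip -SumZ; last by apply: l2_mul; case: dh.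
by congr Sum; apply/funext => x; rewrite ef mulrA.
Qed.
End QuadraticForm.

(** * Existence of eigenfunctions by minimization *)

Section UltrafilterLimits.
Variables (R : realType) (U : set_system nat).
Hypothesis U_ultra : UltraFilter U.

(** One ultrafilter makes all bounded sequences converge at once, so no diagonal subsequence over
    the sites is needed. *)
Lemma ultra_bounded_cvg (u : nat -> R) (M : R) :
  (forall n, `|u n| <= M) -> exists l : R, u n @[n --> U] --> l.
Proof.
move=> uM; have FF : ProperFilter (u n @[n --> U]) by exact: fmap_proper_filter.
have : (u n @[n --> U]) `[-M, M].
  by apply: (@filterE _ U) => n; rewrite /= in_itv /= -ler_norml; exact: uM.
move=> /(@segment_compact _ (-M) M _ FF) [l [_ cl]]; exists l => A lA.
have [//|UnA] := in_ultra_setVsetC (u @^-1` A) U_ultra.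
by have [x [nAx Ax]] := cl (~` A) A UnA lA.
Qed.

Lemma cvg_sumr (I : Type) (r : seq I) (f : I -> nat -> R) (l : I -> R) :
  (forall i, f i n @[n --> U] --> l i) ->
  \sum_(i <- r) f i n @[n --> U] --> \sum_(i <- r) l i.
Proof.
move=> fl; elim: r => [|i r ihr].
  rewrite big_nil (_ : (fun n => _) = fun=> 0); first exact: cvg_cst.
  by apply/funext => n; rewrite big_nil.
rewrite big_cons (_ : (fun n => _) = fun n => f i n + \sum_(j <- r) f j n).
  exact: cvgD.
by apply/funext => n; rewrite big_cons.
Qed.
End UltrafilterLimits.

Section Minimizer.
Variables (R : realType) (d : nat).
Notation T := (site d).
Variables (a : 'I_d -> T -> R) (W : T -> R) (C : R).
Hypothesis a_ge0 : forall i x, 0 <= a i x.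
Hypothesis a_le : forall i x, a i x <= C.
Hypothesis W_ge0 : forall x, 0 <= W x.
Hypothesis W_proper : forall K, exists s : seq T, forall x, W x <= K -> x \in s.
Notation form := (form a W).
Notation fdom := (fdom W).
Notation weak_eigfun := (weak_eigfun a W).

Lemma fdomDZ (t : R) (f g : T -> R) : fdom f -> fdom g -> fdom (fun x => f x + t * g x).
Proof. by move=> df dg; apply: fdomD => //; exact: fdomZ. Qed.

Lemma formDZl (t : R) (f g h : T -> R) : fdom f -> fdom g -> fdom h ->
  form (fun x => f x + t * g x) h = form f h + t * form g h.
Proof.
move=> df dg dh; pose p (b : bool) := if b then f else g.
pose c (b : bool) := if b then 1 else t.
have dp b : fdom (p b) by case: b.
have := form_suml a_ge0 a_le W_ge0 [:: true; false] c dp dh.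
rewrite !big_cons big_nil addr0 /= mul1r => <-.
by congr (form _ h); apply/funext => x; rewrite !big_cons big_nil addr0 /= mul1r.
Qed.

Lemma ipDZl (t : R) (f g h : T -> R) : l2 f -> l2 g -> l2 h ->
  ip (fun x => f x + t * g x) h = ip f h + t * ip g h.
Proof.
move=> df dg dh; rewrite /ip -SumZ -?SumD //; last 3 first.
- exact: l2_mul.
- by apply/l1Z/l2_mul.
- exact: l2_mul.
by congr Sum; apply/funext => x; rewrite mulrDl mulrA.
Qed.

(** Off [s] the potential exceeds [K], so [|f g| <= (W f^2 + W g^2) / (2 K)] there. The bound is
    uniform over functions of bounded energy; this is what prevents the escape of mass. *)
Lemma ip_tail (K M : R) (s : seq T) (f g : T -> R) : 0 < K -> uniq s ->
  (forall x, W x <= K -> x \in s) -> fdom f -> fdom g ->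
  form f f <= M -> form g g <= M ->
  `|ip f g - \sum_(x <- s) f x * g x| <= M / K.
Proof.
move=> K0 us sK df dg fM gM.
have lfg : l1 (fun x => f x * g x) by apply: l2_mul; [case: df|case: dg].
pose F x := if x \in s then f x * g x else 0.
have supF x : F x != 0 -> exists i : seq_sub s, ssval i = x.
  by rewrite /F; case: ifP => [xs _|]; [exists (SeqSub xs)|rewrite eqxx].
have inj : injective (@ssval _ s) by exact: val_inj.
have lF := l1_finite inj supF.
have -> : \sum_(x <- s) f x * g x = Sum F.
  rewrite (Sum_finite inj supF) (eq_big_seq F); last by move=> x xs; rewrite /F xs.
  rewrite -(big_map (@ssval _ s) xpredT F); apply: perm_big.
  apply: uniq_perm => //; first by rewrite map_inj_uniq ?index_enum_uniq.
  move=> x; apply/idP/mapP => [xs|[y _ ->]]; last exact: ssvalP.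
  by exists (SeqSub xs) => //; rewrite mem_index_enum.
rewrite /ip -SumB //.
have dF := l1B lfg lF.
pose G x := (2 * K)^-1 * (W x * f x ^+ 2 + W x * g x ^+ 2).
have lG : l1 G by apply/l1Z/l1D; [case: df|case: dg].
have FG x : `|f x * g x - F x| <= G x.
  rewrite /F; case: ifPn => xs.
    rewrite subrr normr0; apply: mulr_ge0; first by rewrite invr_ge0 mulr_ge0 // ltW.
    by apply: addr_ge0; apply: mulr_ge0 => //; exact: sqr_ge0.
  have KW : K <= W x by rewrite leNgt; apply: contra xs => /ltW/sK.
  rewrite subr0 /G -mulrDr ler_pdivlMl ?mulr_gt0 //.
  have fg : `|f x * g x| * 2 <= f x ^+ 2 + g x ^+ 2.
    rewrite normrM -(real_normK (num_real (f x))) -(real_normK (num_real (g x))).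
    by have := sqr_ge0 (`|f x| - `|g x|); lra.
  rewrite [2 * K]mulrC -mulrA [2 * _]mulrC.
  by apply: ler_pM => //; rewrite ?mulr_ge0 // ltW.
have GM : Sum G <= M / K.
  rewrite /G SumZ ?SumD; try by [case: df|case: dg|apply: l1D; [case: df|case: dg]].
  have := form_geW a_ge0 a_le W_ge0 df; have := form_geW a_ge0 a_le W_ge0 dg.
  move=> h1 h2; rewrite ler_pdivrMl ?mulr_gt0 //.
  have -> : 2 * K * (M / K) = 2 * M by field; rewrite lt0r_neq0.
  by lra.
rewrite ler_norml; apply/andP; split; last first.
  by apply: le_trans GM; apply: Sum_le => // x; apply: le_trans (FG x); exact: ler_norm.
rewrite lerNl -SumN //; apply: le_trans GM; apply: Sum_le => //; first exact: l1N.
by move=> x; apply: le_trans (FG x); rewrite -normrN ler_norm.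
Qed.

Variable U : set_system nat.
Hypothesis U_ultra : UltraFilter U.

Lemma ip_cvg (M : R) (f g : nat -> T -> R) (f' g' : T -> R) :
  (forall n, fdom (f n) /\ form (f n) (f n) <= M) ->
  (forall n, fdom (g n) /\ form (g n) (g n) <= M) ->
  fdom f' /\ form f' f' <= M -> fdom g' /\ form g' g' <= M ->
  (forall x, f n x @[n --> U] --> f' x) -> (forall x, g n x @[n --> U] --> g' x) ->
  ip (f n) (g n) @[n --> U] --> ip f' g'.
Proof.
move=> fM gM [df' f'M] [dg' g'M] ff' gg'.
have M0 : 0 <= M by apply: le_trans f'M; exact: form_ge0.
apply/cvgrPdist_lt => eps eps0.
(* Two tails of at most eps/4 and an error below eps/2 on the finite part add up to less than eps;
   [M + 1] keeps [K] positive when [M = 0]. *)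
pose K := 4 * (M + 1) / eps.
have K0 : 0 < K by rewrite divr_gt0 // mulr_gt0 // ltr_pwDr.
have [s0 s0K] := W_proper K.
pose s := undup s0.
have us : uniq s by exact: undup_uniq.
have sK x : W x <= K -> x \in s by rewrite mem_undup; exact: s0K.
have MK : M / K <= eps / 4.
  rewrite ler_pdivrMr // (_ : eps / 4 * K = M + 1) ?lerDl // /K.
  by field; rewrite lt0r_neq0.
have cs : \sum_(x <- s) f n x * g n x @[n --> U] --> \sum_(x <- s) f' x * g' x.
  by apply: cvg_sumr => x; exact: cvgM.
have e2 : 0 < eps / 2 by rewrite divr_gt0.
move/cvgrPdist_lt/(_ _ e2): cs; apply: filterS => n.
have [dfn fnM] := fM n; have [dgn gnM] := gM n.
have := ip_tail K0 us sK dfn dgn fnM gnM.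
have := ip_tail K0 us sK df' dg' f'M g'M.
by rewrite !ler_norml !ltr_norml => /andP[? ?] /andP[? ?] /andP[? ?]; apply/andP; split; lra.
Qed.

(** Fatou: every finite partial sum converges, and each is bounded by the whole. The fixed bounds
    [M] and [M'] give membership in the domain; the energy bound is asked only eventually, so that
    it can be used with [inf + e] for every e > 0. *)
Lemma form_fatou (M M' : R) (f : nat -> T -> R) (f' : T -> R) :
  (forall n, fdom (f n)) -> (forall n, form (f n) (f n) <= M) ->
  (forall n, ip (f n) (f n) <= M') -> (forall x, f n x @[n --> U] --> f' x) ->
  fdom f' /\ forall E, (\forall n \near U, form (f n) (f n) <= E) -> form f' f' <= E.
Proof.
move=> df fM fM' ff'.
suff df' : fdom f'.
  split=> // E fE; apply: (proj2 (Sum_uniq_le _ _)) => [x|s us]; first exact: edens_ge0.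
  have cs : \sum_(x <- s) edens a W (f n) (f n) x @[n --> U] -->
      \sum_(x <- s) edens a W f' f' x.
    apply: cvg_sumr => x; apply: cvgD; last by apply: cvgM; [exact: cvg_cst|exact: cvgM].
    apply: cvg_sumr => i; apply: cvgM; first exact: cvg_cst.
    by apply: cvgM; apply: cvgB.
  apply: (cvgr_to_le cs); apply: filterS fE => n; apply: le_trans.
  by apply: Sum_uniq_ge => // [x|]; [exact: edens_ge0|exact: l1_edens].
have [lf' _] : l1 (fun x => f' x * f' x) /\ Sum (fun x => f' x * f' x) <= M'.
  apply: Sum_uniq_le => [x|s us]; first by rewrite -expr2 sqr_ge0.
  have cs : \sum_(x <- s) f n x * f n x @[n --> U] --> \sum_(x <- s) f' x * f' x.
    by apply: cvg_sumr => x; exact: cvgM.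
  apply: (cvgr_to_le cs); apply: nearW => n; apply: le_trans (fM' n).
  apply: (@Sum_uniq_ge _ _ (fun x => f n x * f n x)) => // [x|].
    by rewrite -expr2 sqr_ge0.
  by apply: l2_mul; case: (df n).
split; first by [].
have [lW _] : l1 (fun x => W x * f' x ^+ 2) /\ Sum (fun x => W x * f' x ^+ 2) <= M.
  apply: Sum_uniq_le => [x|s us]; first by rewrite mulr_ge0 ?sqr_ge0.
  have cs : \sum_(x <- s) W x * f n x ^+ 2 @[n --> U] --> \sum_(x <- s) W x * f' x ^+ 2.
    apply: cvg_sumr => x; apply: cvgM; first exact: cvg_cst.
    exact: cvgM.
  apply: (cvgr_to_le cs); apply: nearW => n; apply: le_trans (fM n).
  apply: le_trans (form_geW a_ge0 a_le W_ge0 (df n)).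
  apply: (@Sum_uniq_ge _ _ (fun x => W x * f n x ^+ 2)) => // [x|].
    by rewrite mulr_ge0 ?sqr_ge0.
  by case: (df n).
by [].
Qed.

End Minimizer.

Lemma quadratic_ge0_eq0 (R : realFieldType) (b c : R) :
  (forall t, 0 <= 2 * t * b + t ^+ 2 * c) -> b = 0.
Proof.
move=> h; have c0 : 0 <= c by have := h 1; have := h (-1); lra.
have c1 : 0 < c + 1 by rewrite ltr_pwDr.
(* The exact minimizer is -b/c; the denominator [c + 1] covers c = 0 as well. *)
have := h (- b / (c + 1)); have -> : 2 * (- b / (c + 1)) * b + (- b / (c + 1)) ^+ 2 * c =
   - (b ^+ 2 * ((c + 2) / (c + 1) ^+ 2)) by field; rewrite lt0r_neq0.
rewrite oppr_ge0 pmulr_lle0; last by rewrite divr_gt0 ?exprn_gt0 // ltr_wpDl.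
by move=> b0; apply/eqP; rewrite -sqrf_eq0 eq_le b0 sqr_ge0.
Qed.

(** Dimension count, used to find a combination of m functions orthogonal to k < m given ones. *)
Lemma exists_kernel_vector (F : fieldType) (m k : nat) (A : 'I_m -> 'I_k -> F) :
  (k < m)%N -> exists c : 'I_m -> F, (exists i, c i != 0) /\
    forall j, \sum_i c i * A i j = 0.
Proof.
move=> km; pose M := \matrix_(i, j) A i j.
have : kermx M != 0.
  rewrite -mxrank_eq0 mxrank_ker -lt0n subn_gt0.
  exact: leq_ltn_trans (rank_leq_col M) km.
case/rowV0Pn => v /sub_kermxP vM /rV0Pn [i vi].
exists (fun i => v 0 i); split; first by exists i.
move=> j; transitivity ((v *m M) 0 j); last by rewrite vM mxE.
by rewrite mxE; apply: eq_bigr => l _; rewrite mxE.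
Qed.

Section Existence.
Variables (R : realType) (d : nat).
Notation T := (site d).
Variables (a : 'I_d -> T -> R) (W : T -> R) (C : R).
Hypothesis a_ge0 : forall i x, 0 <= a i x.
Hypothesis a_le : forall i x, a i x <= C.
Hypothesis W_ge0 : forall x, 0 <= W x.
Hypothesis W_proper : forall K, exists s : seq T, forall x, W x <= K -> x \in s.
Notation form := (form a W).
Notation fdom := (fdom W).
Notation weak_eigfun := (weak_eigfun a W).
Let formDZl := formDZl a_ge0 a_le W_ge0.

Lemma form_sqrDZ t f g : fdom f -> fdom g ->
  form (fun x => f x + t * g x) (fun x => f x + t * g x) =
  form f f + 2 * t * form f g + t ^+ 2 * form g g.
Proof.
move=> df dg; have dt := fdomDZ W_ge0 t df dg.
rewrite formDZl // [form f _]formC [form g _]formC !formDZl // [form g f]formC.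
by ring.
Qed.

Lemma ip_sqrDZ t (f g : T -> R) : l2 f -> l2 g ->
  ip (fun x => f x + t * g x) (fun x => f x + t * g x) =
  ip f f + 2 * t * ip f g + t ^+ 2 * ip g g.
Proof.
move=> df dg; have dt := l2D df (l2Z t dg).
rewrite ipDZl // [ip f _]ipC [ip g _]ipC !ipDZl // [ip g f]ipC.
by ring.
Qed.

Lemma formZZ t f : fdom f -> form (fun x => t * f x) (fun x => t * f x) = t ^+ 2 * form f f.
Proof.
move=> df; rewrite /form -SumZ; last exact: (l1_edens a_ge0 a_le W_ge0).
apply: eq_Sum => x; rewrite /edens mulrDr; congr (_ + _); last by ring.
by rewrite mulr_sumr; apply: eq_bigr => i _; ring.
Qed.

Lemma ipZl t (f g : T -> R) : l2 f -> l2 g -> ip (fun x => t * f x) g = t * ip f g.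
Proof.
by move=> lf lg; rewrite /ip -(SumZ t (l2_mul lf lg)); apply: eq_Sum => x; rewrite mulrA.
Qed.

Section Step.
Variables (k : nat) (g : nat -> T -> R) (mu : nat -> R).
Hypothesis g_eig : forall j, (j < k)%N -> weak_eigfun (mu j) (g j).
Hypothesis g_orth : forall i j, (i < k)%N -> (j < k)%N -> ip (g i) (g j) = (i == j)%:R.

Let perp (f : T -> R) := forall j, (j < k)%N -> ip f (g j) = 0.

Let energies := [set e : R | exists f, [/\ fdom f, perp f, ip f f = 1 & form f f = e]].

Let dg j : (j < k)%N -> fdom (g j).
Proof. by case/g_eig. Qed.

Let lg j : (j < k)%N -> l2 (g j).
Proof. by case/g_eig => -[]. Qed.

Let perpDZ t f h : fdom f -> fdom h -> perp f -> perp h -> perp (fun x => f x + t * h x).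
Proof.
move=> [lf _] [lh _] pf ph j jk.
by rewrite ipDZl ?pf ?ph ?mulr0 ?addr0 //; exact: lg.
Qed.

Let perpZ t f : fdom f -> perp f -> perp (fun x => t * f x).
Proof. by move=> [lf _] pf j jk; rewrite ipZl ?pf ?mulr0 //; exact: lg. Qed.

Let normalize f : fdom f -> perp f -> 0 < ip f f -> energies (form f f / ip f f).
Proof.
move=> df pf f0; exists (fun x => (Num.sqrt (ip f f))^-1 * f x).
have [lf _] := df; have lZ := l2Z (Num.sqrt (ip f f))^-1 lf.
have s2 : (Num.sqrt (ip f f))^-1 ^+ 2 = (ip f f)^-1 by rewrite exprVn sqr_sqrtr // ltW.
split; [exact: fdomZ|exact: perpZ| |by rewrite formZZ // s2 mulrC].
by rewrite ipZl // ipC ipZl // mulrA -expr2 s2 mulVf // lt0r_neq0.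
Qed.

Let energies_lb : lbound energies 0.
Proof. by move=> e [f [df _ _ <-]]; exact: form_ge0. Qed.

Let form_ge_inf f : fdom f -> perp f -> inf energies * ip f f <= form f f.
Proof.
move=> df pf; have [f0|f0] := ltrP 0 (ip f f).
  by rewrite -ler_pdivlMr //; apply: ge_inf; [exists 0|exact: normalize].
by rewrite (_ : ip f f = 0) ?mulr0 ?form_ge0 //; apply/le_anti; rewrite f0 ip_ge0.
Qed.

Let minimizer : energies !=set0 ->
  exists f, [/\ fdom f, perp f, ip f f = 1 & form f f = inf energies].
Proof.
move=> e0; have hi : has_inf energies by split=> //; exists 0.
have fex n : exists f, [/\ fdom f, perp f, ip f f = 1 & form f f <= inf energies + n.+1%:R^-1].
  have n_gt0 : 0 < n.+1%:R^-1 :> R by rewrite invr_gt0 ltr0n.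
  have [e [f [df pf f1 <-]] fe] := inf_adherent n_gt0 hi.
  by exists f; split=> //; exact: ltW.
have [f fP] := choice fex.
have [U [U_ultra subU]] := ultraFilterLemma eventually_filter.
have f_le n x : `|f n x| <= 1.
  have [[lf _] _ f1 _] := fP n.
  by rewrite -(@ler_pXn2r _ 2) ?nnegrE // expr1n real_normK ?num_real // -f1 ip_ge_sqr.
have lim x : exists l : R, f n x @[n --> U] --> l.
  exact: (ultra_bounded_cvg U_ultra (fun n => f_le n x)).
have [f' ff'] := choice lim.
(* [ip_cvg] wants one energy bound for both sequences; the sum lets it apply to the pairing of [f n]
   with the constant sequence [g j], so that orthogonality survives the limit. *)
pose M := inf energies + 1 + \sum_(j < k) form (g j) (g j).
have sum0 : 0 <= \sum_(j < k) form (g j) (g j) by apply: sumr_ge0 => j _; exact: form_ge0.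
have inf0 : 0 <= inf energies by apply: lb_le_inf.
have fM n : fdom (f n) /\ form (f n) (f n) <= M.
  have [df _ _ fe] := fP n; split=> //; apply: (le_trans fe).
  rewrite /M -addrA lerD2l; apply: (@le_trans _ _ 1); last by rewrite lerDl.
  by rewrite invf_le1 ?ler1n ?ltr0n.
have [|df' lim_le] := form_fatou a_ge0 a_le W_ge0 U_ultra (fun n => (fM n).1)
   (fun n => (fM n).2) (M' := 1) _ ff'.
  by move=> n; have [_ _ -> _] := fP n.
have f'M : form f' f' <= M by apply: lim_le; apply: filterE => n; case: (fM n).
have f'inf : form f' f' <= inf energies.
  apply/ler_addgt0Pr => e e_gt0; apply: lim_le; apply: subU.
  apply: filterS (near_infty_natSinv_lt (PosNum e_gt0)) => n /ltW n_le.
  by have [_ _ _ fe] := fP n; apply: (le_trans fe); rewrite lerD2l.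
have f'1 : ip f' f' = 1.
  have := ip_cvg a_ge0 a_le W_ge0 W_proper U_ultra fM fM (conj df' f'M) (conj df' f'M) ff' ff'.
  rewrite (_ : (fun n => _) = fun=> 1).
    by move=> /cvg_lim <- //; rewrite lim_cst.
  by apply/funext => n; have [_ _ -> _] := fP n.
have pf' : perp f'.
  move=> j jk.
  have gM : fdom (g j) /\ form (g j) (g j) <= M.
    split; first exact: dg.
    rewrite /M (bigD1 (Ordinal jk)) //= addrCA lerDl addr_ge0 ?addr_ge0 //.
    by apply: sumr_ge0 => i _; exact: form_ge0.
  have gg x : g j x @[_ --> U] --> g j x by exact: cvg_cst.
  have := ip_cvg a_ge0 a_le W_ge0 W_proper U_ultra fM (fun=> gM) (conj df' f'M) gM ff' gg.
  rewrite (_ : (fun n => _) = fun=> 0).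
    by move=> /cvg_lim <- //; rewrite lim_cst.
  by apply/funext => n; have [_ -> //] := fP n.
exists f'; split=> //; apply/le_anti; rewrite f'inf /=.
by have := form_ge_inf df' pf'; rewrite f'1 mulr1.
Qed.

(** The trial function [f0] makes the constrained minimization nonempty and bounds its minimum by
    [E]. *)
Lemma minimizer_eigfun f0 E : fdom f0 -> perp f0 -> 0 < ip f0 f0 ->
  form f0 f0 <= E * ip f0 f0 ->
  exists f m, [/\ weak_eigfun m f, ip f f = 1, perp f & m <= E].
Proof.
move=> df0 pf0 f0_gt0 f0E; have en0 := normalize df0 pf0 f0_gt0.
have [|f [df pf f1 fm]] := minimizer; first by exists (form f0 f0 / ip f0 f0).
have [lf _] := df.
exists f, (inf energies); split=> //; last first.
  apply: (@le_trans _ _ (form f0 f0 / ip f0 f0)); last by rewrite ler_pdivrMr.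
  by apply: ge_inf => //; exists 0.
split=> // h dh; have [lh _] := dh.
(* Euler-Lagrange in the directions orthogonal to the previous eigenfunctions. *)
have EL p : fdom p -> perp p -> form f p = inf energies * ip f p.
  move=> dp pp; have [lp _] := dp; apply/eqP; rewrite -subr_eq0; apply/eqP.
  apply: (@quadratic_ge0_eq0 _ _ (form p p - inf energies * ip p p)) => t.
  have := form_ge_inf (fdomDZ W_ge0 t df dp) (perpDZ t df dp pf pp).
  by rewrite form_sqrDZ // ip_sqrDZ // f1 fm; lra.
(* Projection of [h] on the earlier eigenfunctions. There the weak equation is trivial:
   [form f (g j) = mu j * ip f (g j)], and [ip f (g j) = 0], so both sides vanish. *)
pose q x := \sum_(j < k) ip h (g j) * g j x.
have dq : fdom q by apply: fdom_sum => // j; exact: dg.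
have [lq _] := dq.
have pq : perp (fun x => h x + -1 * q x).
  move=> j jk; have lgj := lg jk; rewrite ipDZl //.
  rewrite (ip_suml _ (fun i : 'I_k => ip h (g i)) (g := fun i : 'I_k => g i)) //;
    last by move=> i; exact: lg.
  rewrite (bigD1 (Ordinal jk)) //= g_orth // eqxx mulr1 big1 ?addr0; first by rewrite mulN1r subrr.
  move=> i ij; rewrite g_orth // (_ : (_ == _) = false) ?mulr0 //.
  by apply/negbTE; apply: contra ij => /eqP e; apply/eqP/val_inj.
have fq : form f q = 0.
  rewrite (form_sumr a_ge0 a_le W_ge0 _ (fun i : 'I_k => ip h (g i))
    (g := fun i : 'I_k => g i)) // => [|j];
    last exact: dg.
  apply: big1 => j _; rewrite formC; have [_ ->//] := g_eig (ltn_ord j).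
  by rewrite [ip (g j) f]ipC pf ?mulr0.
have ifq : ip f q = 0.
  rewrite (ip_sumr _ (fun i : 'I_k => ip h (g i)) (g := fun i : 'I_k => g i)) // => [|j];
    last exact: lg.
  by apply: big1 => j _; rewrite pf ?mulr0.
have := EL _ (fdomDZ W_ge0 (-1) dh dq) pq.
rewrite formC formDZl // ipC ipDZl // [form q _]formC fq [ip q _]ipC ifq.
by rewrite !mulr0 !addr0 formC ipC.
Qed.
End Step.

(** The existence half of the min-max principle: as long as k < n + 1 eigenfunctions are known, some
    combination of the [w i] is orthogonal to all of them, so the next constrained minimum is still
    at most [E]. *)
Theorem minmax_existence (n : nat) (w : 'I_n.+1 -> T -> R) (E : R) :
  (forall i, fdom (w i)) ->
  (forall c : 'I_n.+1 -> R, (exists i, c i != 0) ->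
    let f x := \sum_i c i * w i x in 0 < ip f f /\ form f f <= E * ip f f) ->
  exists (g : nat -> T -> R) (mu : nat -> R),
    (forall j, (j < n.+1)%N -> weak_eigfun (mu j) (g j) /\ mu j <= E) /\
    forall i j, (i < n.+1)%N -> (j < n.+1)%N -> ip (g i) (g j) = (i == j)%:R.
Proof.
move=> dw wE; have : (n.+1 <= n.+1)%N by [].
(* The induction counts the eigenfunctions found, while [w] keeps all its n + 1 members. *)
elim: {1 3 4 5}n.+1 => [|k ihk] kn; first by exists (fun=> fun=> 0), (fun=> 0).
have [g [mu [gE gorth]]] := ihk (ltnW kn).
have g_eig j : (j < k)%N -> weak_eigfun (mu j) (g j) by move/gE => [].
have [c [c0 cw]] := exists_kernel_vector (fun i (j : 'I_k) => ip (w i) (g j)) kn.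
have [f0_gt0 f0E] := wE c c0.
have [||f [m [fe f1 pf mE]]] := minimizer_eigfun g_eig gorth _ _ f0_gt0 f0E.
- exact: fdom_sum.
- move=> j jk; rewrite ip_suml; [exact: (cw (Ordinal jk))|by move=> i; case: (dw i)|].
  by case: (g_eig j jk) => -[].
exists (fun j => if j == k then f else g j), (fun j => if j == k then m else mu j).
split=> [j|i j].
  by rewrite ltnS leq_eqVlt; case: eqP => //= _ /gE.
rewrite !ltnS [(i <= k)%N]leq_eqVlt [(j <= k)%N]leq_eqVlt.
case: (i =P k) => [->|/eqP ik] /=; case: (j =P k) => [->|/eqP jk] //=.
- by move=> _ _; rewrite eqxx.
- by move=> _ jk'; rewrite pf // eq_sym (negbTE jk).
- by move=> ik' _; rewrite ipC pf // (negbTE ik).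
- exact: gorth.
Qed.
End Existence.

(** * Test functions and localization *)

Section SpanTestFunction.
Variables (R : realType) (d : nat).
Notation T := (site d).
Variables (a : 'I_d -> T -> R) (W : T -> R) (C : R).
Hypothesis a_ge0 : forall i x, 0 <= a i x.
Hypothesis a_le : forall i x, a i x <= C.
Hypothesis W_ge0 : forall x, 0 <= W x.

(** The [m <= n] constraints leave a nonzero combination. The [g k] need not be orthogonal when
    eigenvalues coincide, so the energy bound comes from writing the defect [E * ip f f - form f f]
    as a squared norm. *)
Lemma eigenspan_test_function (n m : nat) (g : 'I_n.+1 -> T -> R) (mu : 'I_n.+1 -> R)
    (E : R) (p : 'I_m -> T -> R) :
  (forall k, weak_eigfun a W (mu k) (g k)) -> (forall k, mu k <= E) -> linindep g ->
  (m <= n)%N -> (forall j, l2 (p j)) ->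
  exists f, [/\ fdom W f, forall j, ip f (p j) = 0, 0 < ip f f &
    form a W f f <= E * ip f f].
Proof.
move=> ge muE gfree mn lp.
have dg k : fdom W (g k) by case: (ge k).
have lg k : l2 (g k) by case: (dg k).
have [c [[k0 ck0] cp]] := exists_kernel_vector (fun k j => ip (g k) (p j)) (mn : (m < n.+1)%N).
pose f x := \sum_k c k * g k x.
have df : fdom W f by exact: fdom_sum.
have [lf _] := df.
exists f; split=> // [j||]; first by rewrite ip_suml.
  have [[x fx]|f0] := pselect (exists x, f x != 0); first exact: ip_gt0 fx.
  have : c k0 = 0.
    apply: gfree => x; apply/eqP/negPn/negP => fx.
    by apply: f0; exists x.
  by move/eqP; rewrite (negbTE ck0).
have orth j k : mu j != mu k -> ip (g j) (g k) = 0.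
  move=> jk; have [_ gj] := ge j; have [_ gk] := ge k.
  have : mu j * ip (g j) (g k) = mu k * ip (g j) (g k).
    by rewrite -gj // ipC -gk // formC.
  by move/eqP; rewrite -subr_eq0 -mulrBl mulf_eq0 subr_eq0 (negbTE jk) => /eqP.
pose s k := Num.sqrt (E - mu k).
pose q x := \sum_k (c k * s k) * g k x.
(* [(E - mu j) <g j, g k> = s j * s k * <g j, g k>], because [<g j, g k> = 0]
   unless [mu j = mu k]. *)
have qE : ip q q = E * ip f f - form a W f f.
  rewrite ip_suml //; last by apply: l2_sum => k _; exact: l2Z.
  rewrite {2}/f (form_suml a_ge0 a_le W_ge0) // ip_suml // mulr_sumr -sumrB.
  apply: eq_bigr => j _; have [_ ->//] := ge j.
  rewrite !ip_sumr // !mulr_sumr -sumrB; apply: eq_bigr => k _.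
  have [jk|/orth ->] := eqVneq (mu j) (mu k); last by rewrite !mulr0 subrr.
  have -> : s k = s j by rewrite /s jk.
  have -> : E = s j ^+ 2 + mu j by rewrite sqr_sqrtr ?subr_ge0 ?subrK.
  by ring.
by rewrite -subr_ge0 -qE ip_ge0.
Qed.
End SpanTestFunction.

Section Localization.
Variables (R : realType) (d : nat).
Notation T := (site d).
Variables (a a' : 'I_d -> T -> R) (W W' : T -> R) (C C' : R).
Hypothesis a_ge0 : forall i x, 0 <= a i x.
Hypothesis a_le : forall i x, a i x <= C.
Hypothesis W_ge0 : forall x, 0 <= W x.
Hypothesis a'_ge0 : forall i x, 0 <= a' i x.
Hypothesis a'_le : forall i x, a' i x <= C'.
Hypothesis W'_ge0 : forall x, 0 <= W' x.
Variables (chi : T -> R) (eps : R).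
Hypothesis eps_gt0 : 0 < eps.
Hypothesis chi_ge0 : forall x, 0 <= chi x.
Hypothesis chi_le1 : forall x, chi x <= 1.
Hypothesis kinetic_le : forall i x, chi x != 0 -> a' i x <= (1 + eps) * a i x.
Hypothesis gradient_le : forall i x,
  a' i x * ((1 + eps^-1) * (chi (shift x i 1) - chi x) ^+ 2) <= eps / d%:R.
Hypothesis potential_le : forall x, chi x != 0 -> W' x <= (1 + eps) * W x + eps.
Variable f : T -> R.
Hypothesis f_dom : fdom W f.
Hypothesis tail_le : forall x, f x != 0 -> 1 - chi x ^+ 2 <= eps + eps * W x.

Let chif x := chi x * f x.
Let lf : l2 f. Proof. by case: f_dom. Qed.
Let lff : l1 (fun x => f x * f x). Proof. exact: l2_mul. Qed.

Let chi2_ge0 x : 0 <= chi x ^+ 2. Proof. exact: sqr_ge0. Qed.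
Let chi2_le1 x : chi x ^+ 2 <= 1. Proof. by rewrite expr_le1. Qed.

Let potential_chif x :
  W' x * chif x ^+ 2 <= (1 + eps) * (W x * f x ^+ 2) + eps * f x ^+ 2.
Proof.
rewrite /chif exprMn; have f2 := sqr_ge0 (f x); have [chi0|chi0] := eqVneq (chi x) 0.
  rewrite chi0 expr0n mul0r mulr0; apply: addr_ge0; apply: mulr_ge0 => //; try exact: ltW.
    by rewrite addr_ge0 // ltW.
  exact: mulr_ge0.
apply: (@le_trans _ _ (W' x * f x ^+ 2)).
  by rewrite ler_wpM2l // -[leRHS]mul1r ler_wpM2r.
by rewrite mulrA -mulrDl ler_wpM2r // potential_le.
Qed.

Lemma fdom_chi : fdom W' chif.
Proof.
have [_ lW] := f_dom; split.
  by apply: (@l2_bounded_mul _ _ _ 1) => // x; rewrite ger0_norm.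
apply: (l1_le _ (l1D (l1Z (1 + eps) lW) (l1Z eps lf))) => x.
by rewrite ger0_norm ?potential_chif // mulr_ge0 ?sqr_ge0.
Qed.

(** Discrete product rule with the cut-off frozen at [x] in front of the gradient, then Young's
    inequality with parameter eps. One factor [1 + eps] comes from Young, the other from
    [kinetic_le]; freezing at [x] is why [kinetic_le] concerns only sites with [chi x != 0]. *)
Let kinetic_chif i x :
  a' i x * ((chif (shift x i 1) - chif x) * (chif (shift x i 1) - chif x)) <=
  (1 + eps) ^+ 2 * (a i x * ((f (shift x i 1) - f x) * (f (shift x i 1) - f x)))
  + eps / d%:R * (f (shift x i 1) * f (shift x i 1)).
Proof.
rewrite /chif -!expr2; set y := shift x i 1.
have e1 : 0 < 1 + eps by rewrite ltr_wpDl.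
set u := chi x * (f y - f x); set v := (chi y - chi x) * f y.
have -> : chi y * f y - chi x * f x = u + v by rewrite /u /v; ring.
have uv : (u + v) ^+ 2 <= (1 + eps) * u ^+ 2 + (1 + eps^-1) * v ^+ 2.
  rewrite -subr_ge0 (_ : _ - _ = eps^-1 * (eps * u - v) ^+ 2).
    by rewrite mulr_ge0 ?invr_ge0 ?sqr_ge0 ?ltW.
  by field; rewrite lt0r_neq0.
apply: (le_trans (ler_wpM2l (a'_ge0 i x) uv)); rewrite mulrDr; apply: lerD; last first.
  rewrite /v exprMn; have := ler_wpM2r (sqr_ge0 (f y)) (gradient_le i x).
  by rewrite -/y !mulrA.
rewrite /u exprMn; have [chi0|chi0] := eqVneq (chi x) 0.
  rewrite chi0 expr0n mul0r !mulr0.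
  by apply: mulr_ge0; [rewrite exprn_ge0 // ltW|apply: mulr_ge0 => //; exact: sqr_ge0].
rewrite mulrCA [(1 + eps) ^+ 2]expr2 -[leRHS]mulrA ler_pM2l //.
apply: (@le_trans _ _ (a' i x * (f y - f x) ^+ 2)).
  by rewrite ler_wpM2l // -[leRHS]mul1r ler_wpM2r ?sqr_ge0.
by rewrite mulrA ler_wpM2r ?sqr_ge0 ?kinetic_le.
Qed.

(** Of the error [2 * eps], one eps collects the d gradient terms of size eps/d, using that
    translations preserve [ip f f]; the other is the additive error of the potential. *)
Lemma form_chi_le :
  form a' W' chif chif <= (1 + eps) ^+ 2 * form a W f f + 2 * eps * ip f f.
Proof.
have e1 : 0 <= 1 + eps by rewrite addr_ge0 // ltW.
have lsh i : l1 (fun x => f (shift x i 1) * f (shift x i 1)).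
  exact: (l1_bij (shift_bij i) lff).
have lG : l1 (fun x => \sum_(i < d) eps / d%:R * (f (shift x i 1) * f (shift x i 1))).
  by apply: l1_sum => i _; exact: l1Z.
have lE := l1Z ((1 + eps) ^+ 2) (l1_edens a_ge0 a_le W_ge0 f_dom f_dom).
apply: (@le_trans _ _ (Sum (fun x => (1 + eps) ^+ 2 * edens a W f f x +
  (\sum_(i < d) eps / d%:R * (f (shift x i 1) * f (shift x i 1)) + eps * (f x * f x))))).
  apply: Sum_le => [||x].
  - exact: (l1_edens a'_ge0 a'_le W'_ge0 fdom_chi fdom_chi).
  - by apply: l1D => //; apply: l1D => //; exact: l1Z.
  rewrite /edens [(1 + eps) ^+ 2 * (_ + _)]mulrDr addrACA mulr_sumr -big_split /=.
  apply: lerD; first by apply: ler_sum => i _; exact: kinetic_chif.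
  rewrite -!expr2; apply: (le_trans (potential_chif x)); rewrite lerD2r ler_wpM2r //.
    by rewrite mulr_ge0 ?sqr_ge0.
  by rewrite -[leLHS]mulr1 expr2 ler_wpM2l // lerDl ltW.
have lff' := l1Z eps lff.
rewrite (SumD lE (l1D lG lff')) (SumD lG lff').
rewrite (SumZ _ (l1_edens a_ge0 a_le W_ge0 f_dom f_dom)) (SumZ _ lff) -/(form a W f f).
rewrite -/(ip f f) Sum_sum; last by move=> i _; exact: l1Z.
rewrite (eq_bigr (fun=> eps / d%:R * ip f f)) => [|i _]; last first.
  by rewrite SumZ // (Sum_bij (fun x => f x * f x) (shift_bij i)).
have -> : 2 * eps * ip f f = eps * ip f f + eps * ip f f by ring.
rewrite sumr_const card_ord lerD2l lerD2r -[leLHS]mulr_natr.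
have [d0|d0] := eqVneq (d%:R : R) 0.
  by rewrite d0 mulr0; apply: mulr_ge0; [exact: ltW|exact: ip_ge0].
by rewrite mulrAC divfK.
Qed.

(** The mass removed by the cut-off is paid for by potential energy, through [tail_le]. *)
Lemma ip_chi_ge : (1 - eps) * ip f f - eps * form a W f f <= ip chif chif.
Proof.
have [_ lW] := f_dom; have lWf := l1Z eps lW.
have lcc : l1 (fun x => chif x * chif x) by apply: l2_mul; case: fdom_chi.
have lf1 := l1Z (1 - eps) lff.
have h : (1 - eps) * ip f f - eps * Sum (fun x => W x * f x ^+ 2) <= ip chif chif.
  rewrite /ip -!SumZ // -SumB //; apply: Sum_le => [||x]; [exact: l1B|by []|].
  rewrite /chif mulrACA -!expr2.
  have [->|/tail_le] := eqVneq (f x) 0; first by rewrite expr0n !mulr0 subrr.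
  by move=> t; rewrite mulrA -mulrBl ler_wpM2r ?sqr_ge0 //; move: t; lra.
apply: le_trans h; rewrite lerD2l lerN2 ler_pM2l //.
exact: (form_geW a_ge0 a_le W_ge0 f_dom).
Qed.
End Localization.

(** * Kravchuk functions and the solvable oscillator *)

Section Kravchuk.
Variables (R : realType) (n : nat).

Definition kravchuk_poly (j : nat) : {poly R} := (1 + 'X) ^+ (n - j) * (1 - 'X) ^+ j.

(** Logarithmic derivative: [(1 - X^2) p' / p = (n - j) (1 - X) - j (1 + X)]. The operator on the
    left is [2 S_x] on homogeneous polynomials of degree n in two variables, with one variable set
    to 1. *)
Lemma kravchuk_poly_ode j : (j <= n)%N ->
  n%:R *: ('X * kravchuk_poly j) + (1 - 'X ^+ 2) * (kravchuk_poly j)^`() =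
  (n%:R - 2 * j%:R) *: kravchuk_poly j.
Proof.
move=> jn; rewrite /kravchuk_poly; set m := (n - j)%N.
have nE : n%:R = m%:R + j%:R :> R by rewrite -natrD subnK.
have dA k : (1 + 'X) * ((1 + 'X) ^+ k)^`() = k%:R * (1 + 'X) ^+ k :> {poly R}.
  rewrite deriv_exp derivD derivC derivX add0r mul1r -mulr_natl.
  by case: k => [|k]; [rewrite !mul0r mulr0|rewrite exprS /=; ring].
have dB k : (1 - 'X) * ((1 - 'X) ^+ k)^`() = - (k%:R * (1 - 'X) ^+ k) :> {poly R}.
  rewrite deriv_exp derivB derivC derivX sub0r mulN1r mulNrn mulrN -mulr_natl.
  by case: k => [|k]; [rewrite !mul0r mulr0|rewrite exprS /=; ring].
rewrite derivM -!mul_polyC nE !rmorphB !rmorphD !rmorphM /= polyC_natr.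
set A := (1 + 'X) ^+ m; set B := (1 - 'X) ^+ j.
have -> : (1 - 'X ^+ 2) * (A^`() * B + A * B^`()) =
   (1 - 'X) * ((1 + 'X) * A^`()) * B + (1 + 'X) * A * ((1 - 'X) * B^`()) by ring.
by rewrite dA dB -/A -/B; ring.
Qed.

Lemma kravchuk_poly_coef j k : (j <= n)%N -> (k <= n)%N ->
  (n%:R - 2 * j%:R) * (kravchuk_poly j)`_k =
  (if k is k'.+1 then (n - k')%:R * (kravchuk_poly j)`_k' else 0)
  + k.+1%:R * (kravchuk_poly j)`_k.+1.
Proof.
move=> jn kn; have := congr1 (fun p : {poly R} => p`_k) (kravchuk_poly_ode jn).
rewrite coefZ => <-; rewrite mulrBl mul1r coefD coefB coefZ coefXM coefXnM !coef_deriv.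
case: k kn => [|[|k]] kn /=.
- by rewrite mulr0 subr0 mulr_natl.
- by rewrite subr0 subn0 !mulr_natl.
have -> : (k.+2 - 2)%N = k by rewrite subn2.
rewrite natrB; last exact: leq_trans kn.
by rewrite mulrBl !mulr_natl addrA addrAC.
Qed.

(** Entry of [2 S_x] between neighbouring weights for spin n/2; it vanishes at k = n, which closes
    the matrix. *)
Definition kravchuk_offdiag (k : nat) : R := Num.sqrt (k.+1 * (n - k))%:R.

(** The coefficient recurrence has the entries [n - k] and [k + 1] on the two sides of the diagonal;
    the square root of the binomial weight symmetrizes it, replacing both by their geometric
    mean. *)
Let b j k := (kravchuk_poly j)`_k / Num.sqrt 'C(n, k)%:R.

Let offE k : kravchuk_offdiag k = Num.sqrt k.+1%:R * Num.sqrt (n - k)%:R.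
Proof. by rewrite /kravchuk_offdiag natrM sqrtrM ?ler0n. Qed.

Let sqrt_bin k : Num.sqrt k.+1%:R * Num.sqrt 'C(n, k.+1)%:R =
  Num.sqrt (n - k)%:R * Num.sqrt 'C(n, k)%:R :> R.
Proof. by rewrite -!sqrtrM ?ler0n // -!natrM mul_bin_left. Qed.

Let sqrt_bin_neq0 k : (k <= n)%N -> Num.sqrt 'C(n, k)%:R != 0 :> R.
Proof. by move=> kn; rewrite sqrtr_eq0 -ltNge ltr0n bin_gt0. Qed.

Let ratio k : (k < n)%N -> Num.sqrt (n - k)%:R / Num.sqrt 'C(n, k.+1)%:R =
  Num.sqrt k.+1%:R / Num.sqrt 'C(n, k)%:R :> R.
Proof.
by move=> kn; apply/eqP; rewrite eqr_div ?sqrt_bin_neq0 ?sqrt_bin // ltnW.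
Qed.

Lemma size_kravchuk_poly j : (j <= n)%N -> (size (kravchuk_poly j) <= n.+1)%N.
Proof.
move=> jn; have sA : (size (1 + 'X : {poly R})%R <= 2)%N by rewrite addrC size_XaddC.
have sB : (size (1 - 'X : {poly R})%R <= 2)%N by rewrite -opprB size_polyN size_XsubC.
have se k (p : {poly R}) : (size p <= 2)%N -> (size (p ^+ k)%R <= k.+1)%N.
  move=> sp; apply: (leq_trans (size_poly_exp_leq _ _)); rewrite ltnS -[leqRHS]mul1n.
  by rewrite leq_mul2r; apply/orP; right; case: (size p) sp => [|[|[|]]].
have := leq_add (se (n - j)%N _ sA) (se j _ sB); rewrite addSn addnS subnK // => h.
by apply: leq_trans (size_polyMleq _ _) _; move: h; case: (_ + _)%N.
Qed.

Let b_rec j k : (j <= n)%N -> (k <= n)%N ->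
  (n%:R - 2 * j%:R) * b j k =
  (if k is k'.+1 then kravchuk_offdiag k' * b j k' else 0) + kravchuk_offdiag k * b j k.+1.
Proof.
move=> jn kn; rewrite /b mulrA kravchuk_poly_coef // mulrDl; congr (_ + _).
  case: k kn => [|k] kn; first by rewrite mul0r.
  rewrite offE -[(n - k)%:R in LHS](@sqr_sqrtr _ (n - k)%:R) ?ler0n //.
  rewrite [RHS](_ : _ = Num.sqrt (n - k)%:R * (kravchuk_poly j)`_k *
    (Num.sqrt k.+1%:R / Num.sqrt 'C(n, k)%:R)); last by ring.
  by rewrite -ratio //; ring.
move: kn; rewrite leq_eqVlt => /predU1P[->|kn].
  by rewrite /kravchuk_offdiag subnn muln0 sqrtr0 nth_default ?size_kravchuk_poly //
    !(mulr0, mul0r).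
rewrite offE -[k.+1%:R in LHS](@sqr_sqrtr _ k.+1%:R) ?ler0n //.
rewrite [LHS](_ : _ = Num.sqrt k.+1%:R * (kravchuk_poly j)`_k.+1 *
  (Num.sqrt k.+1%:R / Num.sqrt 'C(n, k)%:R)); last by ring.
by rewrite -ratio //; ring.
Qed.

Let dot (u v : nat -> R) := \sum_(k < n.+1) u k * v k.

(** The right side is symmetric in j and l. This is self-adjointness of the tridiagonal matrix, and
    orthogonality follows because the eigenvalues [n - 2 j] are distinct. *)
Let dot_b j l : (j <= n)%N -> (n%:R - 2 * j%:R) * dot (b j) (b l) =
  \sum_(k < n.+1) kravchuk_offdiag k * (b j k * b l k.+1 + b j k.+1 * b l k).
Proof.
move=> jn; rewrite /dot mulr_sumr.
rewrite (eq_bigr (fun k : 'I_n.+1 =>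
  (if k : nat is k'.+1 then kravchuk_offdiag k' * b j k' else 0) * b l k +
  kravchuk_offdiag k * (b j k.+1 * b l k))); last first.
  by move=> k _; rewrite mulrA b_rec -1?ltnS // mulrDl -!mulrA.
rewrite big_split /= big_ord_recl mul0r add0r.
rewrite [X in _ = X](eq_bigr _ (fun k _ => mulrDr _ _ _)) [RHS]big_split /=.
congr (_ + _); rewrite [RHS]big_ord_recr /=.
rewrite [X in _ = _ + X](_ : _ = 0) ?addr0; last first.
  by rewrite /kravchuk_offdiag subnn muln0 sqrtr0 mul0r.
by apply: eq_bigr => k _; exact: esym (mulrA _ _ _).
Qed.

Let b_orth j l : (j <= n)%N -> (l <= n)%N -> j != l -> dot (b j) (b l) = 0.
Proof.
move=> jn ln jl.
have : (n%:R - 2 * j%:R) * dot (b j) (b l) = (n%:R - 2 * l%:R) * dot (b j) (b l).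
  have -> : dot (b j) (b l) = dot (b l) (b j).
    by apply: eq_bigr => k _; rewrite mulrC.
  rewrite [in RHS]dot_b // (_ : dot (b l) (b j) = dot (b j) (b l)).
    by rewrite dot_b //; apply: eq_bigr => k _; rewrite addrC ![_ * b l _]mulrC.
  by apply: eq_bigr => k _; rewrite mulrC.
move/eqP; rewrite -subr_eq0 -mulrBl mulf_eq0 => /orP[|/eqP //].
rewrite opprB addrC subrKA -mulrBr mulf_eq0 pnatr_eq0 /= subr_eq0 eqr_nat.
by rewrite eq_sym (negbTE jl).
Qed.

Let norm2 j := dot (b j) (b j).

Let norm2_gt0 j : 0 < norm2 j.
Proof.
have b0 : b j 0 = 1.
  rewrite /b bin0 sqrtr1 divr1 -horner_coef0 /kravchuk_poly hornerM !horner_exp.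
  by rewrite !hornerE subr0 !expr1n mul1r.
rewrite /norm2 /dot big_ord_recl /= b0 mulr1; apply: ltr_pwDl => //.
by apply: sumr_ge0 => k _; rewrite -expr2 sqr_ge0.
Qed.

(** Extended by zero to j > n, so that directions with different spins share one index range
    ['I_K]. *)
Definition kravchuk (j k : nat) : R := if (j <= n)%N then b j k / Num.sqrt (norm2 j) else 0.

Lemma kravchuk_out j k : (n < k)%N -> kravchuk j k = 0.
Proof.
by rewrite /kravchuk /b; case: ifP => // _ nk; rewrite bin_small // sqrtr0 invr0 mulr0 mul0r.
Qed.

Lemma kravchuk_rec j k : (j <= n)%N -> (k <= n)%N ->
  (n%:R - 2 * j%:R) * kravchuk j k =
  (if k is k'.+1 then kravchuk_offdiag k' * kravchuk j k' else 0)
  + kravchuk_offdiag k * kravchuk j k.+1.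
Proof.
move=> jn kn; rewrite /kravchuk jn mulrA b_rec // mulrDl; congr (_ + _); last by rewrite -mulrA.
by case: k kn => [|k] kn; [rewrite mul0r|rewrite -mulrA].
Qed.

Let widen_sum K (F : nat -> R) : (n < K)%N -> (forall k, (n < k)%N -> F k = 0) ->
  \sum_(k < K) F k = \sum_(k < n.+1) F k.
Proof.
move=> nK F0; rewrite -!(big_mkord xpredT) (big_cat_nat (n := n.+1)) //=.
by rewrite [X in _ + X]big_nat_cond [X in _ + X]big1 ?addr0 // => k /andP[/andP[/F0]].
Qed.

Lemma kravchuk_orth K j l : (n < K)%N ->
  \sum_(k < K) kravchuk j k * kravchuk l k = ((j == l) && (j <= n)%N)%:R.
Proof.
move=> nK; rewrite (widen_sum (F := fun k => kravchuk j k * kravchuk l k)) //; last first.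
  by move=> k nk; rewrite kravchuk_out // mul0r.
rewrite /kravchuk; have [jn|jn] := boolP (j <= n)%N; last first.
  by rewrite andbF big1 // => k _; rewrite mul0r.
rewrite andbT; have [<-|jl] := eqVneq j l.
  rewrite jn (eq_bigr (fun k : 'I_n.+1 => (norm2 j)^-1 * (b j k * b j k))).
    by rewrite -mulr_sumr mulVf // lt0r_neq0.
  move=> k _; rewrite mulrACA -invfM -[X in _ / X]expr2 sqr_sqrtr ?(ltW (norm2_gt0 j)) //.
  by rewrite mulrC.
have [ln|ln] := boolP (l <= n)%N; last by rewrite big1 // => k _; rewrite mulr0.
rewrite (eq_bigr (fun k : 'I_n.+1 =>
    (Num.sqrt (norm2 j))^-1 * (Num.sqrt (norm2 l))^-1 * (b j k * b l k))).
  by rewrite -mulr_sumr -/(dot _ _) b_orth // mulr0.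
by move=> k _; ring.
Qed.

(** A square matrix with orthonormal rows has orthonormal columns. *)
Lemma kravchuk_complete K k k' : (n < K)%N ->
  \sum_(j < K) kravchuk j k * kravchuk j k' = ((k == k') && (k <= n)%N)%:R.
Proof.
move=> nK; rewrite (widen_sum (F := fun j => kravchuk j k * kravchuk j k')) //; last first.
  by move=> j nj; rewrite /kravchuk leqNgt nj mul0r.
have [kn|nk] := leqP k n; last first.
  by rewrite andbF big1 // => j _; rewrite kravchuk_out ?mul0r.
have [kn'|nk'] := leqP k' n; last first.
  rewrite (_ : (k == k') = false); last by apply/eqP => e; move: kn; rewrite e leqNgt nk'.
  by rewrite big1 // => j _; rewrite [kravchuk _ k']kravchuk_out ?mulr0.
pose P : 'M[R]_n.+1 := \matrix_(j, k) kravchuk j k.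
have PP : P *m P^T = 1%:M.
  apply/matrixP => j l; rewrite !mxE.
  have := kravchuk_orth j l (ltnSn n); rewrite -ltnS ltn_ord andbT val_eqE => <-.
  by apply: eq_bigr => i _; rewrite !mxE.
have := congr1 (fun M : 'M[R]_n.+1 => M (inord k) (inord k')) (mulmx1C PP).
rewrite !mxE andbT -val_eqE /= !inordK // => <-.
by apply: eq_bigr => j _; rewrite !mxE !inordK.
Qed.
End Kravchuk.

Section KravchukOscillator.
Variables (R : realType) (d : nat) (omega : 'I_d -> R) (s : 'I_d -> nat).
Hypothesis omega_gt0 : forall i, 0 < omega i.
Notation T := (site d).

(** The radicand is [(p - z) (p + z + 1)] with the square completed, which exhibits a circle of
    radius p + 1/2. For edges not inside the box it is at most 0, and [Num.sqrt] returns 0 without a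
    case distinction. *)
Definition hopping (p : nat) (z : int) : R :=
  Num.sqrt ((p%:R + 2^-1) ^+ 2 - (z%:~R + 2^-1) ^+ 2).

Lemma hopping_ge0 p z : 0 <= hopping p z. Proof. exact: sqrtr_ge0. Qed.

Lemma hopping_le p z : hopping p z <= p%:R + 2^-1.
Proof.
have p0 : 0 <= p%:R + 2^-1 :> R by rewrite addr_ge0.
rewrite -[leRHS]ger0_norm // -sqrtr_sqr ler_wsqrtr // lerBlDr lerDl sqr_ge0 //.
Qed.

Lemma hopping_edge p (z : int) : (z = - (p%:Z + 1) \/ z = p%:Z) -> hopping p z = 0.
Proof.
rewrite /hopping => -[] ->; rewrite ?rmorphN ?rmorphD /= ?pmulrn;
  by rewrite (_ : _ - _ = 0) ?sqrtr0 //; field.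
Qed.

Lemma hopping_offdiag p (k : nat) : (k <= p.*2)%N ->
  hopping p (k%:Z - p%:Z) = kravchuk_offdiag R p.*2 k.
Proof.
move=> kp; rewrite /hopping /kravchuk_offdiag; congr Num.sqrt.
by rewrite natrM natrB // -mul2n natrM rmorphB /= -!pmulrn -natr1; field.
Qed.

Definition basis1 (p k : nat) (z : int) : R :=
  if z + p%:Z is Posz y then kravchuk R p.*2 k y else 0.

Lemma basis1_nat p k (y : nat) : basis1 p k (y%:Z - p%:Z) = kravchuk R p.*2 k y.
Proof. by rewrite /basis1 subrK. Qed.

(** J has eigenvalue p - k on the k-th Kravchuk function, so [p + 1/2 - J] has the oscillator level
    k + 1/2. Outside the box both sides vanish, because the edges leaving the box carry no hopping;
    for k > 2p the function itself is zero. *)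
Lemma basis1_rec p k z :
  (p%:R + 2^-1) * basis1 p k z - hopping p z / 2 * basis1 p k (z + 1)
    - hopping p (z - 1) / 2 * basis1 p k (z - 1) = (k%:R + 2^-1) * basis1 p k z.
Proof.
have [kp|kp] := leqP k p.*2; last first.
  have b0 w : basis1 p k w = 0 by rewrite /basis1 /kravchuk leqNgt kp; case: (w + _).
  by rewrite !b0 !mulr0 !subr0.
have zE : z = (z + p%:Z) - p%:Z by rewrite addrK.
rewrite {}zE; case: (z + p%:Z) => [y|y].
  have [yp|yp] := leqP y p.*2; last first.
    have b0 w : (p.*2 < w)%N -> basis1 p k (w%:Z - p%:Z) = 0.
      by move=> h; rewrite basis1_nat kravchuk_out.
    have e1 : y%:Z - p%:Z + 1 = y.+1%:Z - p%:Z by lia.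
    case: y yp e1 => // y yp e1; have e2 : y.+1%:Z - p%:Z - 1 = y%:Z - p%:Z by lia.
    rewrite e1 e2 !(b0 y.+1) ?(b0 y.+2) ?mulr0 ?sub0r ?subr0 //; last exact: leq_trans yp _.
    move: yp; rewrite ltnS leq_eqVlt => /predU1P[<-|yp].
      by rewrite hopping_edge; [rewrite !mul0r oppr0 addr0|right; lia].
    by rewrite b0 // mulr0 oppr0 addr0.
  have e1 : y%:Z - p%:Z + 1 = y.+1%:Z - p%:Z by lia.
  rewrite e1 !basis1_nat hopping_offdiag //; have := kravchuk_rec R kp yp.
  case: y yp e1 => [|y] yp _ rec.
    rewrite sub0r hopping_edge; last by left; lia.
    rewrite mul0r mul0r subr0; move: rec; rewrite add0r -mul2n natrM.
    by lra.
  have -> : y.+1%:Z - p%:Z - 1 = y%:Z - p%:Z by lia.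
  rewrite basis1_nat hopping_offdiag ?(ltnW yp) //.
  by move: rec; rewrite -mul2n natrM; lra.
have b0 w : w + p%:Z < 0 -> basis1 p k w = 0 by rewrite /basis1; case: (w + p%:Z).
have [->|y0] := eqVneq y 0%N.
  rewrite hopping_edge; last by left; lia.
  by rewrite !mul0r subr0 !b0 ?mulr0 ?subr0 //; lia.
by rewrite !b0 ?mulr0 ?subr0 //; lia.
Qed.

Definition kinetic_K (i : 'I_d) (x : T) : R := omega i * (hopping (s i) (x i) / 2).

(** The diagonal [omega i * (s i + 1/2)] minus the weights of the two edges in direction i: what is
    left of K once its hopping is written with differences of f. *)
Definition potential_K (x : T) : R :=
  \sum_i omega i * ((s i)%:R + 2^-1 - (hopping (s i) (x i) + hopping (s i) (x i - 1)) / 2).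

Lemma kinetic_K_ge0 i x : 0 <= kinetic_K i x.
Proof. by rewrite mulr_ge0 ?divr_ge0 ?hopping_ge0 // ltW. Qed.

Lemma potential_K_ge0 x : 0 <= potential_K x.
Proof.
apply: sumr_ge0 => i _; apply: mulr_ge0; first exact: ltW.
by have := hopping_le (s i) (x i); have := hopping_le (s i) (x i - 1); lra.
Qed.

Definition basis (m : 'I_d -> nat) (x : T) : R := \prod_i basis1 (s i) (m i) (x i).

Let shift_at (x : T) i z j : shift x i z j = if j == i then x j + z else x j.
Proof. by rewrite ffunE. Qed.

Lemma basis_shift m x i z :
  basis m (shift x i z) = basis1 (s i) (m i) (x i + z) *
    \prod_(j | j != i) basis1 (s j) (m j) (x j).
Proof.
rewrite /basis (bigD1 i) //= shift_at eqxx; congr (_ * _).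
by apply: eq_bigr => j /negbTE ji; rewrite shift_at ji.
Qed.

Lemma basis_fop (m : {ffun 'I_d -> nat}) x :
  fop kinetic_K potential_K (basis m) x = harm_level omega m * basis m x.
Proof.
rewrite /fop /potential_K /harm_level mulr_suml -big_split /= mulr_sumr mulr_suml.
apply: eq_bigr => i _; rewrite !basis_shift /kinetic_K shift_at eqxx.
have -> : basis m x = basis1 (s i) (m i) (x i) * \prod_(j | j != i) basis1 (s j) (m j) (x j).
  by rewrite /basis (bigD1 i).
set P := \prod_(j | _) _; have := basis1_rec (s i) (m i) (x i).
set u := basis1 _ _ (x i); set v := basis1 _ _ (x i + 1); set w := basis1 _ _ (x i - 1).
move=> rec.
transitivity (omega i * (((m i)%:R + 2^-1) * u) * P); first by rewrite -rec; field.
by field.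
Qed.
End KravchukOscillator.

Section KravchukBasis.
Variables (R : realType) (d : nat) (omega : 'I_d -> R) (s : 'I_d -> nat) (K : nat).
Hypothesis omega_gt0 : forall i, 0 < omega i.
Hypothesis s_lt_K : forall i, ((s i).*2 < K)%N.
Notation T := (site d).
Notation J := {ffun 'I_d -> 'I_K}.
Notation Psi := (@basis R d s).
Notation form := (form (kinetic_K omega s) (potential_K omega s)).
Notation fdom := (fdom (potential_K omega s)).

Definition box_site (k : J) : T := [ffun i => (k i : nat)%:Z - (s i)%:Z].

Definition in_box (x : T) : bool := [forall i, `|x i| <= (s i)%:Z].

Definition multi (m : J) : {ffun 'I_d -> nat} := [ffun i => m i : nat].

Lemma box_site_inj : injective box_site.
Proof.
move=> k l e; apply/ffunP => i; have := congr1 (fun x : T => x i) e.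
by rewrite !ffunE => /addIr [] /val_inj.
Qed.

Lemma in_box_site x : in_box x -> exists k, box_site k = x.
Proof.
move=> /forallP xs.
have h i : (absz (x i + (s i)%:Z)%R < K)%N.
  by have := xs i; have := s_lt_K i; rewrite -mul2n; lia.
exists [ffun i => Ordinal (h i)]; apply/ffunP => i; rewrite !ffunE /=.
by have := xs i; lia.
Qed.

Lemma in_box_siteE k : in_box (box_site k) = [forall i, (k i <= (s i).*2)%N].
Proof.
by apply: eq_forallb => i; rewrite ffunE -mul2n; apply/idP/idP; lia.
Qed.

Lemma basis_box m k : Psi m (box_site k) = \prod_i kravchuk R (s i).*2 (m i) (k i).
Proof. by apply: eq_bigr => i _; rewrite ffunE basis1_nat. Qed.

Lemma basis_in_box m x : Psi m x != 0 -> in_box x.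
Proof.
move=> bx; apply/forallP => i; apply/negPn/negP => xi; case/negP: bx.
rewrite /basis (bigD1 i) //= mulf_eq0; apply/orP; left; apply/eqP.
rewrite /basis1; case e : (x i + _) => [y|//]; rewrite kravchuk_out //.
by move: xi e; rewrite -mul2n; lia.
Qed.

Let box_finite (F : T -> R) : (forall x, F x != 0 -> in_box x) ->
  l1 F /\ Sum F = \sum_k F (box_site k).
Proof.
move=> supF; have h x : F x != 0 -> exists k, box_site k = x.
  by move/supF/in_box_site.
split; [refine (l1_finite box_site_inj h)|exact (Sum_finite box_site_inj h)].
Qed.

Lemma in_box_fdom f : (forall x, f x != 0 -> in_box x) -> fdom f.
Proof.
move=> fb; split; apply: (proj1 (box_finite _)) => x.
  by rewrite expf_eq0 /=; exact: fb.
by rewrite mulf_eq0 negb_or expf_eq0 /= => /andP[_]; exact: fb.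
Qed.

Lemma basis_fdom m : fdom (Psi m).
Proof. by apply: in_box_fdom => x; exact: basis_in_box. Qed.

Let ip_box (f g : T -> R) : (forall x, f x != 0 -> in_box x) ->
  ip f g = \sum_k f (box_site k) * g (box_site k).
Proof.
move=> fb; apply: (proj2 (box_finite _)) => x.
by rewrite mulf_eq0 negb_or => /andP[+ _]; exact: fb.
Qed.

Lemma basis_orth (m m' : {ffun 'I_d -> nat}) : (forall i, (m i <= (s i).*2)%N) ->
  ip (Psi m) (Psi m') = (m == m')%:R.
Proof.
move=> ms; rewrite ip_box; last by move=> x; exact: basis_in_box.
rewrite (eq_bigr (fun k : J => \prod_i
   (kravchuk R (s i).*2 (m i) (k i) * kravchuk R (s i).*2 (m' i) (k i)))); last first.
  by move=> k _; rewrite !basis_box -big_split.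
rewrite -(bigA_distr_bigA (fun i (j : 'I_K) =>
  kravchuk R (s i).*2 (m i) j * kravchuk R (s i).*2 (m' i) j)) /=.
rewrite (eq_bigr (fun i => (m i == m' i)%:R)); last first.
  by move=> i _; rewrite kravchuk_orth // ms andbT.
have [->|mm'] := eqVneq m m'; first by rewrite big1 // => i _; rewrite eqxx.
have [i mi] : exists i, m i != m' i.
  apply/existsP; rewrite -negb_forall; apply: contra mm' => /forallP h.
  by apply/eqP/ffunP => i; apply/eqP.
by rewrite (bigD1 i) //= (negbTE mi) mul0r.
Qed.

Lemma basis_complete (k k' : J) :
  \sum_(m : J) Psi (multi m) (box_site k) * Psi (multi m) (box_site k') =
  ((k == k') && in_box (box_site k))%:R.
Proof.
rewrite (eq_bigr (fun m : J => \prod_i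
   (kravchuk R (s i).*2 (m i) (k i) * kravchuk R (s i).*2 (m i) (k' i)))); last first.
  by move=> m _; rewrite !basis_box -big_split; apply: eq_bigr => i _; rewrite !ffunE.
rewrite -(bigA_distr_bigA (fun i (j : 'I_K) =>
  kravchuk R (s i).*2 j (k i) * kravchuk R (s i).*2 j (k' i))) /=.
rewrite (eq_bigr (fun i => ((k i == k' i) && (k i <= (s i).*2)%N)%:R)); last first.
  by move=> i _; rewrite kravchuk_complete.
rewrite in_box_siteE; have [/andP[/eqP <- /forallP h]|] := boolP (_ && _).
  by rewrite big1 // => i _; rewrite eqxx h.
move=> nkk; have [i ki] : exists i, ~~ ((k i == k' i) && (k i <= (s i).*2)%N).
  apply/existsP; rewrite -negb_forall; apply: contra nkk => /forallP h.
  apply/andP; split; last by apply/forallP => i; case/andP: (h i).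
  by apply/eqP/ffunP => i; apply/eqP; case/andP: (h i).
by rewrite (bigD1 i) //= (negbTE ki) mul0r.
Qed.

Section Expansion.
Variable f : T -> R.
Hypothesis f_box : forall x, f x != 0 -> in_box x.

Let coef (m : J) := ip f (Psi (multi m)).

Lemma basis_expansion x : f x = \sum_m coef m * Psi (multi m) x.
Proof.
have [/in_box_site [k' <-]|xb] := boolP (in_box x); last first.
  rewrite (_ : f x = 0); last by apply/eqP; apply: contraNT xb; exact: f_box.
  rewrite big1 // => m _; rewrite (_ : Psi _ x = 0) ?mulr0 //.
  by apply/eqP; apply: contraNT xb; exact: basis_in_box.
rewrite (eq_bigr (fun m => \sum_k f (box_site k) *
    (Psi (multi m) (box_site k) * Psi (multi m) (box_site k')))); last first.
  move=> m _; rewrite /coef ip_box // mulr_suml.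
  by apply: eq_bigr => k _; rewrite mulrA.
rewrite exchange_big /= (bigD1 k') //= [X in _ = _ + X]big1 ?addr0.
  rewrite -mulr_sumr basis_complete eqxx /=.
  by have [_|/(contraNN (@f_box _))/negPn/eqP ->] := boolP (in_box _);
    rewrite ?mulr1 ?mul0r.
by move=> k kk'; rewrite -mulr_sumr basis_complete (negbTE kk') mulr0.
Qed.

Let f_eq : f = fun x => \sum_m coef m * Psi (multi m) x.
Proof. by apply/funext => x; exact: basis_expansion. Qed.

Let C := \sum_i omega i * ((s i)%:R + 2^-1).

Lemma kinetic_K_le i x : kinetic_K omega s i x <= C.
Proof.
apply: (@le_trans _ _ (omega i * ((s i)%:R + 2^-1))).
  rewrite ler_pM2l //; have := hopping_le R (s i) (x i).
  by have := hopping_ge0 R (s i) (x i); lra.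
rewrite /C (bigD1 i) //= lerDl; apply: sumr_ge0 => j _.
by apply: mulr_ge0; [exact: ltW|rewrite addr_ge0].
Qed.

Lemma basis_weak_eigfun (m : {ffun 'I_d -> nat}) :
  weak_eigfun (kinetic_K omega s) (potential_K omega s) (harm_level omega m) (Psi m).
Proof.
apply: (fop_weak_eigfun _ kinetic_K_le) => //; first by move=> *; exact: kinetic_K_ge0.
- by move=> *; exact: potential_K_ge0.
- by case: (basis_fdom m).
- exact: basis_fop.
Qed.

(** Parseval in the Kravchuk basis. Indices in [J] with some m_i > 2 s_i are harmless, since their
    basis function is zero. *)
Lemma form_kravchuk_ge E :
  (forall m : J, harm_level omega (multi m) < E -> ip f (Psi (multi m)) = 0) ->
  E * ip f f <= form f f.
Proof.
move=> fE; have df := in_box_fdom f_box; have [lf _] := df.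
have a0 i x : 0 <= kinetic_K omega s i x by exact: kinetic_K_ge0.
have W0 x : 0 <= potential_K omega s x by exact: potential_K_ge0.
have -> : ip f f = \sum_m coef m * coef m.
  rewrite {1}f_eq ip_suml //; last by move=> m; case: (basis_fdom (multi m)).
  by apply: eq_bigr => m _; rewrite ipC.
have -> : form f f = \sum_m coef m * (harm_level omega (multi m) * coef m).
  rewrite {1}f_eq (form_suml a0 kinetic_K_le W0) //; last by move=> m; exact: basis_fdom.
  by apply: eq_bigr => m _; have [_ ->//] := basis_weak_eigfun (multi m); rewrite ipC.
rewrite mulr_sumr; apply: ler_sum => m _; rewrite [leRHS]mulrCA.
have [Em|/fE] := lerP E (harm_level omega (multi m)).
  by rewrite ler_wpM2r // -expr2 sqr_ge0.
by rewrite -/(coef m) => ->; rewrite !mulr0.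
Qed.
End Expansion.

Lemma form_kravchuk_le (p : nat) (m : 'I_p -> {ffun 'I_d -> nat}) (c : 'I_p -> R) E :
  injective m -> (forall k i, (m k i <= (s i).*2)%N) ->
  (forall k, harm_level omega (m k) <= E) ->
  let f x := \sum_k c k * Psi (m k) x in
  ip f f = \sum_k c k ^+ 2 /\ form f f <= E * ip f f.
Proof.
move=> m_inj ms mE f.
have a0 i x : 0 <= kinetic_K omega s i x by exact: kinetic_K_ge0.
have W0 x : 0 <= potential_K omega s x by exact: potential_K_ge0.
have dg k : fdom (Psi (m k)) by exact: basis_fdom.
have lg k : l2 (Psi (m k)) by case: (dg k).
have df : fdom f by apply: fdom_sum.
have [lf _] := df.
have cE k : ip (Psi (m k)) f = c k.
  rewrite ip_sumr // (bigD1 k) //= basis_orth // eqxx mulr1 big1 ?addr0 //.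
  move=> j jk; rewrite basis_orth // (_ : (_ == _) = false) ?mulr0 //.
  by apply/negbTE; apply: contra jk => /eqP/m_inj ->.
have ffE : ip f f = \sum_k c k ^+ 2.
  by rewrite {1}/f ip_suml //; apply: eq_bigr => k _; rewrite cE.
split=> //; rewrite ffE {1}/f (form_suml a0 kinetic_K_le W0) // mulr_sumr.
apply: ler_sum => k _; have [_ ->//] := basis_weak_eigfun (m k).
by rewrite cE mulrCA -expr2 ler_wpM2r ?sqr_ge0.
Qed.
End KravchukBasis.

(** * Comparison of the two oscillators *)

Lemma int_norm_le_of_sqr (z b : int) : z ^+ 2 <= b -> `|z| <= b.
Proof. by move=> h; nia. Qed.

Section Comparison.
Variables (R : realType) (d : nat) (omega : 'I_d -> R).
Notation T := (site d).

Definition kinetic_A (L : R) (i : 'I_d) (x : T) : R := L / 2.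

Definition potential_A (L : R) (x : T) : R :=
  \sum_i omega i ^+ 2 * (x i)%:~R ^+ 2 / (2 * L).

Definition tent (rho : R) (x : T) : R := Num.max 0 (1 - (\sum_i `|(x i)%:~R|) / rho).

Lemma tent_ge0 rho x : 0 <= tent rho x.
Proof. by rewrite le_max lexx. Qed.

Lemma tent_le1 rho x : 0 < rho -> tent rho x <= 1.
Proof.
move=> rho0; rewrite ge_max ler01 gerBl.
by apply: divr_ge0; [exact: sumr_ge0|exact: ltW].
Qed.

Lemma tent_lipschitz rho x i : 0 < rho ->
  (tent rho (shift x i 1) - tent rho x) ^+ 2 <= rho^-1 ^+ 2.
Proof.
move=> rho0.
have max_lip (u v : R) : `|Num.max 0 u - Num.max 0 v| <= `|u - v|.
  case: (leP 0 u) => u0; case: (leP 0 v) => v0 //; last by rewrite subrr normr0.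
    by rewrite subr0 ger0_norm // ler_normr; apply/orP; left; lra.
  by rewrite sub0r normrN ger0_norm // ler_normr; apply/orP; right; lra.
have sumD : `|\sum_j `|(shift x i 1 j)%:~R : R| - \sum_j `|(x j)%:~R : R| | <= 1.
  rewrite -sumrB (bigD1 i) //= big1 ?addr0.
    rewrite ffunE eqxx rmorphD /=; apply: (le_trans (ler_dist_dist _ _)).
    by rewrite addrC addKr normr1.
  by move=> j /negbTE ji; rewrite ffunE ji subrr.
rewrite -(real_normK (num_real (tent _ _ - _))) lerXn2r ?nnegrE ?invr_ge0 ?(ltW rho0) //.
apply: (le_trans (max_lip _ _)); rewrite opprB addrC addrA subrK -mulrBl normrM.
by rewrite [`|rho^-1|]gtr0_norm ?invr_gt0 // -[leRHS]mul1r ler_pM2r ?invr_gt0 // distrC.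
Qed.

Lemma tent_support rho x i : 0 < rho -> tent rho x != 0 -> `|(x i)%:~R : R| <= rho.
Proof.
move=> rho0; rewrite /tent maxEle; case: ifP => [h _|_]; last by rewrite eqxx.
move: h; rewrite subr_ge0 ler_pdivrMr // mul1r; apply: le_trans.
by rewrite (bigD1 i) //= lerDl sumr_ge0.
Qed.

Variables (Omega kappa eps L : R) .
Hypothesis d_gt0 : (0 < d)%N.
Hypothesis kappa_gt0 : 0 < kappa.
Hypothesis kappa_le : forall i, kappa <= omega i.
Hypothesis le_Omega : forall i, omega i <= Omega.
Hypothesis Omega_gt0 : 0 < Omega.
Hypothesis eps_gt0 : 0 < eps.
Hypothesis eps_le1 : eps <= 1.
(** Small enough for [(1 + eps)^2 ((1 - eta)^2 - 4 eta^2) >= 1], needed in [hopping_ge_L]. The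
    radius [rho] then makes [omega i * rho <= eta * L] in every direction. *)
Let eta := eps / 10.
Let rho := eta / Omega * L.
Hypothesis L_gt0 : 0 < L.
(** One largeness condition per error: rounding of the spins, slope of the tent, the half-site
    offset of the edges in the potential, and mass beyond the tent. *)
Hypothesis L_Omega : Omega <= 2 * eta * L.
Hypothesis L_gradient : L * (1 + eps^-1) * rho^-1 ^+ 2 <= eps / d%:R.
Hypothesis L_potential : Omega ^+ 2 <= eps / d%:R * L.
Hypothesis L_tail : d%:R / (eps * rho ^+ 2) <= eps / 2 * (kappa ^+ 2 / (2 * L)).

Let omega_gt0 i : 0 < omega i. Proof. exact: lt_le_trans kappa_gt0 (kappa_le i). Qed.
Let eta_gt0 : 0 < eta. Proof. by rewrite divr_gt0. Qed.
Let eta_le1 : eta <= 1.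
Proof. by rewrite ler_pdivrMr //; move: eps_le1; lra. Qed.
Let rho_gt0 : 0 < rho. Proof. by rewrite mulr_gt0 // divr_gt0. Qed.
Let d_gt0R : 0 < d%:R :> R. Proof. by rewrite ltr0n. Qed.

Definition spin (i : 'I_d) : nat := Num.truncn (L / omega i).
Let sigma i : R := (spin i)%:R + 2^-1.

Lemma spin_itv i : (spin i)%:R <= L / omega i < (spin i)%:R + 1.
Proof. by rewrite natr1; apply: truncn_itv; rewrite divr_ge0 // ltW. Qed.

Let omega_sigma i : L * (1 - eta) <= omega i * sigma i <= L * (1 + eta).
Proof.
have := spin_itv i; rewrite ler_pdivlMr // ltr_pdivrMr // => /andP[h1 h2].
have := le_Omega i; rewrite /sigma => h3; have h4 := L_Omega; apply/andP; split; lra.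
Qed.

Let rho_omega i : omega i * rho <= eta * L.
Proof.
rewrite /rho mulrA ler_pM2r // mulrCA -[leRHS]mulr1 ler_pM2l //.
by rewrite ler_pdivrMr // mul1r.
Qed.

Lemma hopping_le_L i z : omega i * hopping R (spin i) z <= (1 + eps) * L.
Proof.
have /andP[_ h] := omega_sigma i.
have := hopping_le R (spin i) z; rewrite -/(sigma i) -(ler_pM2l (omega_gt0 i)) => h2.
apply: (le_trans h2); apply: (le_trans h); rewrite mulrC ler_wpM2r ?(ltW L_gt0) // /eta.
by move: eps_gt0; lra.
Qed.

(** After multiplication by [omega i] the radius of the circle is at least [L (1 - eta)] and the
    abscissa at most [2 eta L]: one eta from [rho], one from the offset 1/2 via [L_Omega]. *)
Lemma hopping_ge_L i (z : int) : `|z%:~R + 2^-1 : R| <= rho + 2^-1 ->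
  L / ((1 + eps) * omega i) <= hopping R (spin i) z.
Proof.
move=> hz; have w0 := omega_gt0 i; have e1 : 0 < 1 + eps by rewrite ltr_wpDl.
have q0 : 0 <= L / ((1 + eps) * omega i) by rewrite divr_ge0 ?mulr_ge0 // ltW.
rewrite /hopping -(ger0_norm q0) -sqrtr_sqr ler_wsqrtr //.
rewrite -/(sigma i) -(real_normK (num_real (z%:~R + 2^-1))); set u := `|_|.
have u0 : 0 <= u by exact: normr_ge0.
have wu : omega i * u <= 2 * eta * L.
  have := rho_omega i; have := le_Omega i; move: L_Omega => h1 h2 h3.
  by have := ler_wpM2l (ltW w0) hz; rewrite mulrDr -/u; lra.
have wu2 : (omega i * u) ^+ 2 <= (2 * eta * L) ^+ 2.
  by rewrite lerXn2r ?nnegrE ?mulr_ge0 // ltW.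
have /andP[ws _] := omega_sigma i.
have ws2 : (L * (1 - eta)) ^+ 2 <= (omega i * sigma i) ^+ 2.
  have L0 : 0 <= L * (1 - eta).
    by apply: mulr_ge0; [exact: ltW|rewrite subr_ge0; exact: eta_le1].
  by rewrite lerXn2r ?nnegrE // (le_trans L0).
rewrite -(@ler_pM2l _ (omega i ^+ 2)) ?exprn_gt0 // mulrBr -!exprMn.
apply: (@le_trans _ _ (L ^+ 2 * ((1 - eta) ^+ 2 - 4 * eta ^+ 2))); last first.
  by move: wu2 ws2; rewrite !exprMn; lra.
rewrite (_ : omega i * _ = L / (1 + eps)); last by field; rewrite !lt0r_neq0.
rewrite expr_div_n ler_pM2l ?exprn_gt0 // -[X in X <= _]mul1r ler_pdivrMr ?exprn_gt0 //.
have -> : eps = 10 * eta by rewrite /eta; field.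
have eta1 : 10 * eta <= 1 by rewrite /eta mulrC divfK.
have := eta_gt0; nra.
Qed.

Let c i z := hopping R (spin i) z.
Let u (z : int) : R := z%:~R + 2^-1.

(** On the circle, [sigma - c = u^2 / (sigma + c)]; bounds on the denominator from both sides give
    the quadratic well. *)
Let hopping_sqr i z : `|u z| <= sigma i -> (sigma i - c i z) * (sigma i + c i z) = u z ^+ 2.
Proof.
move=> us; rewrite -subr_sqr /c /hopping sqr_sqrtr; first by rewrite -/(sigma i) /u; ring.
rewrite subr_ge0 -/(sigma i) -/(u z) -(real_normK (num_real (u z))) lerXn2r ?nnegrE //.
exact: le_trans us.
Qed.

Let sigma_gt0 i : 0 < sigma i. Proof. by rewrite ltr_wpDl. Qed.

Let hopping_potential_le i z : `|u z| <= rho + 2^-1 -> `|u z| <= sigma i ->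
  sigma i - c i z <= u z ^+ 2 * ((1 + eps) * omega i / (2 * L)).
Proof.
move=> uz us; have := hopping_ge_L i uz; rewrite -/(c i z); set q := L / _ => qc.
have w0 := omega_gt0 i; have e1 : 0 < 1 + eps by rewrite ltr_wpDl.
have q0 : 0 < q by rewrite divr_gt0 // mulr_gt0.
have cs : c i z <= sigma i by exact: hopping_le.
rewrite (_ : (1 + eps) * _ / _ = (2 * q)^-1); last by rewrite /q; field; rewrite !lt0r_neq0.
rewrite ler_pdivlMr; last exact: mulr_gt0.
have := hopping_sqr us.
have : 0 <= (sigma i - c i z) * (sigma i + c i z - 2 * q).
  by rewrite mulr_ge0 ?subr_ge0 //; lra.
by lra.
Qed.

Let hopping_potential_ge i z : `|u z| <= sigma i ->
  u z ^+ 2 / (2 * sigma i) <= sigma i - c i z.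
Proof.
move=> us; have cs : c i z <= sigma i by exact: hopping_le.
rewrite ler_pdivrMr; last by apply: mulr_gt0.
have := hopping_sqr us.
have : 0 <= (sigma i - c i z) * (2 * sigma i - (sigma i + c i z)).
  by rewrite mulr_ge0 ?subr_ge0 //; lra.
by lra.
Qed.

(** The linear terms of the two edges at z cancel. The constant 1/2 is the source of the additive
    error in [potential_K_le]. *)
Let u_sqr z : u z ^+ 2 + u (z - 1) ^+ 2 = 2 * z%:~R ^+ 2 + 2^-1.
Proof. by rewrite /u rmorphB /=; field. Qed.

Let u_le z r : `|z%:~R : R| <= r -> `|u z| <= r + 2^-1 /\ `|u (z - 1)| <= r + 2^-1.
Proof.
by rewrite /u rmorphB /= !ler_norml => /andP[h1 h2]; split; apply/andP; split; lra.
Qed.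

Lemma rho_le_spin i z : `|z%:~R : R| <= rho -> `|z| <= (spin i)%:Z.
Proof.
move=> zr; rewrite -(ler_int R) intr_norm -pmulrn; apply: (le_trans zr).
have /andP[_ h] := spin_itv i; move: h; rewrite ltr_pdivrMr // => h.
rewrite -(ler_pM2l (omega_gt0 i)); apply: (le_trans (rho_omega i)).
have := mulr_gt0 eta_gt0 L_gt0; have := le_Omega i; have := L_Omega.
have : 10 * (eta * L) <= L.
  by rewrite mulrA -[leRHS]mul1r ler_wpM2r ?(ltW L_gt0) // /eta mulrC divfK.
by lra.
Qed.

Lemma potential_K_le x : tent rho x != 0 ->
  potential_K omega spin x <= (1 + eps) * potential_A L x + eps.
Proof.
move=> tx; rewrite /potential_K /potential_A mulr_sumr.
have epsE : \sum_(i < d) eps / d%:R = eps.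
  by rewrite sumr_const card_ord -[LHS]mulr_natr divfK // lt0r_neq0.
rewrite -[X in _ <= _ + X]epsE -big_split /=; apply: ler_sum => i _.
have xr := tent_support i rho_gt0 tx; have [ur ur'] := u_le xr.
have := rho_le_spin i xr; rewrite -(ler_int R) intr_norm -pmulrn => /u_le [us us'].
have h1 := hopping_potential_le ur us; have h2 := hopping_potential_le ur' us'.
have w0 := omega_gt0 i; set Q := (1 + eps) * omega i / (2 * L) in h1 h2.
have h3 := ler_wpM2l (ltW w0) (lerD h1 h2).
rewrite -[X in _ <= omega i * X]mulrDl u_sqr in h3.
have h4 : (1 + eps) * (omega i ^+ 2 / (8 * L)) <= eps / d%:R.
  have wO : omega i ^+ 2 <= eps / d%:R * L.
    by apply: le_trans L_potential; rewrite lerXn2r ?nnegrE ?(ltW w0) ?(ltW Omega_gt0).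
  have : omega i ^+ 2 / (8 * L) <= eps / d%:R / 8.
    rewrite ler_pdivrMr ?mulr_gt0 // (_ : _ * (8 * L) = eps / d%:R * L) //.
    by field; rewrite lt0r_neq0.
  have p0 : 0 <= omega i ^+ 2 / (8 * L) by rewrite divr_ge0 ?sqr_ge0 ?mulr_ge0 // ltW.
  move: p0; set p := _ / _; set r := eps / d%:R; have := eps_le1; have := eps_gt0; nra.
have -> : (1 + eps) * (omega i ^+ 2 * (x i)%:~R ^+ 2 / (2 * L)) =
  omega i * ((2 * (x i)%:~R ^+ 2 + 2^-1) * Q) / 2 - (1 + eps) * (omega i ^+ 2 / (8 * L)).
  by rewrite /Q; field; rewrite lt0r_neq0.
by move: h3 h4; rewrite /c -/(sigma i); lra.
Qed.

(** Valid in the whole box and without additive error: it uses only [c <= sigma], and the constant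
    of [u_sqr] has the favourable sign. Hence tails can be controlled for every function supported
    in the box. *)
Lemma potential_A_le x : in_box spin x ->
  potential_A L x <= (1 + eps) * potential_K omega spin x.
Proof.
move=> /forallP xb; rewrite /potential_K /potential_A mulr_sumr; apply: ler_sum => i _.
have := xb i; rewrite -(ler_int R) intr_norm -pmulrn => /u_le [us us'].
have h1 := hopping_potential_ge us; have h2 := hopping_potential_ge us'.
have w0 := omega_gt0 i; have := lerD h1 h2; rewrite -mulrDl u_sqr => h3.
have s0 := sigma_gt0 i; have e1 : 0 < 1 + eps by rewrite ltr_wpDl.
have /andP[_ ws] := omega_sigma i.
have h4 : omega i ^+ 2 * (x i)%:~R ^+ 2 / (2 * L) <=
    (1 + eps) * (omega i * ((2 * (x i)%:~R ^+ 2 + 2^-1) / (2 * sigma i) / 2)).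
  have := sqr_ge0 ((x i)%:~R : R); set X := (x i)%:~R ^+ 2 => X0.
  have wsL : omega i * sigma i <= (1 + eps) * L.
    by apply: (le_trans ws); rewrite mulrC ler_wpM2r ?(ltW L_gt0) // /eta; have := eps_gt0; lra.
  rewrite ler_pdivrMr ?mulr_gt0 //.
  apply: (@le_trans _ _ (omega i * X / sigma i * ((1 + eps) * L))); last first.
    rewrite -subr_ge0 (_ : _ - _ = (1 + eps) * omega i * L / (sigma i * 4)).
      by rewrite divr_ge0 ?mulr_ge0 ?(ltW w0) ?(ltW L_gt0) ?(ltW e1) ?(ltW s0).
    by field; rewrite lt0r_neq0.
  apply: (@le_trans _ _ (omega i * X / sigma i * (omega i * sigma i))).
    by rewrite (_ : _ * (omega i * sigma i) = omega i ^+ 2 * X) //; field; rewrite lt0r_neq0.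
  rewrite ler_wpM2l //; apply: divr_ge0; last exact: ltW.
  by apply: mulr_ge0 => //; exact: ltW.
apply: (le_trans h4); rewrite ler_pM2l // ler_pM2l //.
by move: h3; rewrite /c -/(sigma i); lra.
Qed.

(** The deficit [1 - tent^2] is at most twice the l^1 norm over [rho]; the arithmetic-geometric
    inequality in each coordinate makes it quadratic. The factor [eps / 2] leaves room for
    [1 + eps <= 2] in the passage from A to K. *)
Let tail_bound x : 1 - tent rho x ^+ 2 <= eps + eps / 2 * potential_A L x.
Proof.
have r0 : 0 <= (\sum_i `|(x i)%:~R : R|) / rho.
  by apply: divr_ge0; [apply: sumr_ge0|exact: ltW].
have h1 : 1 - tent rho x ^+ 2 <= 2 * ((\sum_i `|(x i)%:~R : R|) / rho).
  rewrite /tent; set r := _ / rho; case: (leP 0 (1 - r)) => h.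
    by have := sqr_ge0 r; lra.
  by move: h; lra.
apply: (le_trans h1); rewrite mulr_suml mulr_sumr.
have epsE : \sum_(i < d) eps / d%:R = eps.
  by rewrite sumr_const card_ord -[LHS]mulr_natr divfK // lt0r_neq0.
rewrite -[X in _ <= X + _]epsE /potential_A mulr_sumr -big_split /=; apply: ler_sum => i _.
rewrite -[(x i)%:~R ^+ 2](real_normK (num_real _)); set X := `|_|.
apply: (@le_trans _ _ (eps / d%:R + d%:R / (eps * rho ^+ 2) * X ^+ 2)).
  rewrite -subr_ge0 (_ : _ - _ = eps / d%:R * (1 - d%:R / (eps * rho) * X) ^+ 2).
    by rewrite mulr_ge0 ?sqr_ge0 ?divr_ge0 ?(ltW eps_gt0).
  by field; rewrite !lt0r_neq0.
rewrite lerD2l (_ : eps / 2 * _ = eps / 2 * (omega i ^+ 2 / (2 * L)) * X ^+ 2); last first.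
  by field; rewrite lt0r_neq0.
rewrite ler_wpM2r ?sqr_ge0 //; apply: (le_trans L_tail).
rewrite ler_pM2l ?divr_gt0 // ler_pM2r ?invr_gt0 ?mulr_gt0 //.
by rewrite lerXn2r ?nnegrE ?(ltW kappa_gt0) ?(ltW (omega_gt0 i)) ?kappa_le.
Qed.

Let potential_A_ge0 x : 0 <= potential_A L x.
Proof.
apply: sumr_ge0 => i _; apply: divr_ge0; first by apply: mulr_ge0; exact: sqr_ge0.
by rewrite mulr_ge0 // ltW.
Qed.

Lemma tail_A x : 1 - tent rho x ^+ 2 <= eps + eps * potential_A L x.
Proof.
by apply: (le_trans (tail_bound x)); have := potential_A_ge0 x; have := eps_gt0; nra.
Qed.

Lemma tail_K x : in_box spin x -> 1 - tent rho x ^+ 2 <= eps + eps * potential_K omega spin x.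
Proof.
move=> xb; apply: (le_trans (tail_bound x)); rewrite lerD2l -mulrA ler_pM2l //.
have := potential_A_le xb; have := potential_K_ge0 spin omega_gt0 x.
have := eps_le1; have := eps_gt0; nra.
Qed.

Lemma kinetic_A_le i x : tent rho x != 0 ->
  kinetic_A L i x <= (1 + eps) * kinetic_K omega spin i x.
Proof.
move=> tx; have [ur _] := u_le (tent_support i rho_gt0 tx).
have := hopping_ge_L i ur; have w0 := omega_gt0 i; have e1 : 0 < 1 + eps by rewrite ltr_wpDl.
rewrite ler_pdivrMr ?mulr_gt0 // /kinetic_A /kinetic_K; lra.
Qed.

Lemma kinetic_K_le_A i x : kinetic_K omega spin i x <= (1 + eps) * kinetic_A L i x.
Proof. by have := hopping_le_L i (x i); rewrite /kinetic_A /kinetic_K; lra. Qed.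

Let gradient_bound t i x : 0 <= t -> t <= L ->
  t * ((1 + eps^-1) * (tent rho (shift x i 1) - tent rho x) ^+ 2) <= eps / d%:R.
Proof.
move=> t0 tL; apply: le_trans L_gradient; rewrite mulrA.
have e0 : 0 <= 1 + eps^-1 by rewrite addr_ge0 // invr_ge0 ltW.
by apply: ler_pM; [exact: mulr_ge0|exact: sqr_ge0|rewrite ler_wpM2r
  |exact: tent_lipschitz].
Qed.

Lemma gradient_A i x :
  kinetic_A L i x * ((1 + eps^-1) * (tent rho (shift x i 1) - tent rho x) ^+ 2) <= eps / d%:R.
Proof. by apply: gradient_bound; rewrite /kinetic_A; have := L_gt0; lra. Qed.

Lemma gradient_K i x :
  kinetic_K omega spin i x * ((1 + eps^-1) * (tent rho (shift x i 1) - tent rho x) ^+ 2)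
  <= eps / d%:R.
Proof.
apply: gradient_bound; first exact: kinetic_K_ge0.
apply: (le_trans (kinetic_K_le_A i x)); rewrite /kinetic_A.
by have := L_gt0; have := eps_le1; nra.
Qed.

Lemma tent_in_box x : tent rho x != 0 -> in_box spin x.
Proof.
by move=> tx; apply/forallP => i; apply: rho_le_spin; exact: tent_support.
Qed.

Let aA_ge0 i x : 0 <= kinetic_A L i x. Proof. by rewrite divr_ge0 // ltW. Qed.
Let aA_le i x : kinetic_A L i x <= L / 2. Proof. by []. Qed.
Let aK_ge0 i x : 0 <= kinetic_K omega spin i x. Proof. exact: kinetic_K_ge0. Qed.
Let WK_ge0 x : 0 <= potential_K omega spin x. Proof. exact: potential_K_ge0. Qed.

Lemma potential_A_proper M : exists s : seq T, forall x, potential_A L x <= M -> x \in s.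
Proof.
(* [B] bounds the squares of the coordinates; for integers [z^2 <= B] already gives [|z| <= B],
   which saves a square root. *)
pose B := Num.bound `|M * (2 * L) / kappa ^+ 2|.
exists (codom (@box_site d (fun=> B) B.*2.+1)) => x xM.
have xB i : `|x i| <= B%:Z.
  have k2 : 0 < kappa ^+ 2 by rewrite exprn_gt0.
  have L2 : 0 < 2 * L by rewrite mulr_gt0.
  have xi : omega i ^+ 2 * (x i)%:~R ^+ 2 / (2 * L) <= M.
    apply: le_trans xM; rewrite /potential_A (bigD1 i) //= lerDl; apply: sumr_ge0 => j _.
    by apply: divr_ge0; [apply: mulr_ge0; exact: sqr_ge0|exact: ltW].
  have xk : (x i)%:~R ^+ 2 <= M * (2 * L) / kappa ^+ 2.
    rewrite ler_pdivlMr //; move: xi; rewrite ler_pdivrMr // => xi; apply: le_trans xi.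
    rewrite mulrC ler_wpM2r ?sqr_ge0 //.
    by rewrite lerXn2r ?nnegrE ?(ltW kappa_gt0) ?(ltW (omega_gt0 i)) ?kappa_le.
  have xlt : (x i)%:~R ^+ 2 < B%:R :> R.
    by apply: (le_lt_trans xk); apply: le_lt_trans (ler_norm _) (archi_boundP (normr_ge0 _)).
  by apply/int_norm_le_of_sqr/ltW; rewrite -(ltr_int R) rmorphXn /= -pmulrn.
have /(@in_box_site d (fun=> B) B.*2.+1) [//|k <-] : in_box (fun=> B) x by apply/forallP.
exact: codom_f.
Qed.

Let chi := tent rho.

Lemma localize_A f : fdom (potential_A L) f ->
  [/\ form (kinetic_K omega spin) (potential_K omega spin)
        (fun x => chi x * f x) (fun x => chi x * f x) <=
      (1 + eps) ^+ 2 * form (kinetic_A L) (potential_A L) f f + 2 * eps * ip f f,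
    (1 - eps) * ip f f - eps * form (kinetic_A L) (potential_A L) f f <=
      ip (fun x => chi x * f x) (fun x => chi x * f x) &
    forall x, chi x * f x != 0 -> in_box spin x].
Proof.
move=> df; split.
- apply: (form_chi_le aA_ge0 aA_le potential_A_ge0 aK_ge0 (kinetic_K_le spin omega_gt0) WK_ge0
    eps_gt0 _ _ _ gradient_K _ df) => //.
  + by move=> x; exact: tent_ge0.
  + by move=> x; exact: tent_le1.
  + by move=> i x _; exact: kinetic_K_le_A.
  + exact: potential_K_le.
- apply: (ip_chi_ge aA_ge0 aA_le potential_A_ge0 WK_ge0 eps_gt0 _ _ _ df) => //.
  + by move=> x; exact: tent_ge0.
  + by move=> x; exact: tent_le1.
  + exact: potential_K_le.
  + by move=> x _; exact: tail_A.
- by move=> x; rewrite mulf_eq0 negb_or => /andP[/tent_in_box].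
Qed.

Lemma localize_K f : (forall x, f x != 0 -> in_box spin x) ->
  [/\ form (kinetic_A L) (potential_A L) (fun x => chi x * f x) (fun x => chi x * f x) <=
      (1 + eps) ^+ 2 * form (kinetic_K omega spin) (potential_K omega spin) f f
        + 2 * eps * ip f f,
    (1 - eps) * ip f f - eps * form (kinetic_K omega spin) (potential_K omega spin) f f <=
      ip (fun x => chi x * f x) (fun x => chi x * f x) &
    fdom (potential_A L) (fun x => chi x * f x)].
Proof.
move=> fb; have aK_le := kinetic_K_le spin omega_gt0.
have spin_lt i : ((spin i).*2 < (\sum_j spin j).*2.+1)%N.
  by rewrite ltnS leq_double (bigD1 i) //= leq_addr.
have df : fdom (potential_K omega spin) f by exact: (in_box_fdom _ spin_lt).
have WA_le x : chi x != 0 -> potential_A L x <= (1 + eps) * potential_K omega spin x + eps.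
  move=> /tent_in_box/potential_A_le h; apply: (le_trans h); rewrite lerDl.
  exact: ltW.
split.
- apply: (form_chi_le aK_ge0 aK_le WK_ge0 aA_ge0 aA_le potential_A_ge0
    eps_gt0 _ _ _ gradient_A WA_le df) => //.
  + by move=> x; exact: tent_ge0.
  + by move=> x; exact: tent_le1.
  + by move=> i x; exact: kinetic_A_le.
- apply: (ip_chi_ge aK_ge0 aK_le WK_ge0 potential_A_ge0 eps_gt0 _ _ WA_le df) => //.
  + by move=> x; exact: tent_ge0.
  + by move=> x; exact: tent_le1.
  + by move=> x /fb; exact: tail_K.
- apply: (fdom_chi WK_ge0 potential_A_ge0 eps_gt0 _ _ WA_le df) => //.
  + by move=> x; exact: tent_ge0.
  + by move=> x; exact: tent_le1.
Qed.

(** A low-energy combination [f] is taken orthogonal to the cut-off Kravchuk functions below [e].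
    Then [chi * f] has K-energy at least [e] times its mass, and localization compares both sides
    with those of [f]. *)
Lemma eigenvalue_lower_bound n (g : 'I_n.+1 -> T -> R) (mu : 'I_n.+1 -> R) (E e : R) K :
  (forall i, ((spin i).*2 < K)%N) ->
  (#|[pred m : {ffun 'I_d -> 'I_K} | (harm_level omega (multi m) < e)%R]| <= n)%N ->
  (forall k, weak_eigfun (kinetic_A L) (potential_A L) (mu k) (g k)) ->
  (forall k, mu k <= E) -> linindep g -> 0 <= e -> E <= e ->
  e * (1 - eps - eps * e) <= (1 + eps) ^+ 2 * E + 2 * eps.
Proof.
move=> spin_lt; set A := [pred m | _] => An gE muE gfree e0 Ee.
(* Multiplication by [chi] is symmetric: orthogonality of [f] to [chi * Psi] is orthogonality of
   [chi * f] to [Psi]. *)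
pose p (j : 'I_#|A|) x := chi x * basis R spin (multi (enum_val j)) x.
have chi1 x : `|chi x| <= 1 by rewrite ger0_norm ?tent_ge0 ?tent_le1.
have lp j : l2 (p j).
  apply: (l2_bounded_mul chi1).
  by case: (@basis_fdom _ _ omega _ K spin_lt (multi (enum_val j))).
have [f [df fp f0 fE]] :=
  eigenspan_test_function aA_ge0 aA_le potential_A_ge0 gE muE gfree An lp.
have [h1 h2 hb] := localize_A df.
have perp (m : {ffun 'I_d -> 'I_K}) : harm_level omega (multi m) < e ->
    ip (fun x => chi x * f x) (basis R spin (multi m)) = 0.
  move=> me; have mA : m \in A by rewrite inE.
  rewrite -(fp (enum_rank_in mA m)) /p enum_rankK_in //.
  by apply: eq_Sum => x; ring.
have h3 := form_kravchuk_ge omega_gt0 spin_lt hb perp.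
set F := ip f f in f0 fE h1 h2; set FA := form _ _ f f in fE h1 h2.
set FC := ip _ _ in h2 h3.
have e1 : 0 < eps := eps_gt0.
have : e * ((1 - eps - eps * e) * F) <= ((1 + eps) ^+ 2 * E + 2 * eps) * F.
  apply: (@le_trans _ _ (e * FC)).
    rewrite ler_wpM2l //; apply: le_trans h2.
    rewrite [_ * F]mulrBl lerD2l lerN2 -mulrA ler_pM2l //; apply: (le_trans fE).
    by rewrite ler_pM2r.
  apply: (le_trans h3); apply: (le_trans h1); rewrite [leRHS]mulrDl lerD2r -mulrA.
  by rewrite ler_pM2l // exprn_gt0 // ltr_wpDl.
by rewrite mulrA ler_pM2r.
Qed.

(** Trial functions are the cut-off Kravchuk functions. Positivity of [1 - eps - eps * e] ensures
    that the cut-off annihilates no nonzero combination of them. *)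
Lemma eigenvalue_upper_bound n (m : 'I_n.+1 -> {ffun 'I_d -> nat}) (E e : R) :
  injective m -> (forall k i, (m k i <= (spin i).*2)%N) ->
  (forall k, harm_level omega (m k) <= e) ->
  0 < 1 - eps - eps * e -> 0 <= E ->
  (1 + eps) ^+ 2 * e + 2 * eps <= E * (1 - eps - eps * e) ->
  exists (g : 'I_n.+1 -> T -> R) (mu : 'I_n.+1 -> R),
    (forall k, weak_eigfun (kinetic_A L) (potential_A L) (mu k) (g k) /\ mu k <= E) /\
    linindep g.
Proof.
move=> m_inj ms me e_small E0 eE.
have spin_lt i : ((spin i).*2 < (\sum_j spin j).*2.+1)%N.
  by rewrite ltnS leq_double (bigD1 i) //= leq_addr.
pose w k x := chi x * basis R spin (m k) x.
have dw k : fdom (potential_A L) (w k).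
  by have [] := @localize_K (basis R spin (m k)) (fun x => @basis_in_box _ _ _ _ x).
have [|g [mu [gE gorth]]] := minmax_existence aA_ge0 aA_le potential_A_ge0
    potential_A_proper (w := w) (E := E) dw.
  move=> b [k0 bk0] f; pose f0 x := \sum_k b k * basis R spin (m k) x.
  have [f0c f0E] := form_kravchuk_le omega_gt0 spin_lt b m_inj ms me.
  rewrite -/f0 in f0c f0E.
  have f0_box x : f0 x != 0 -> in_box spin x.
    move=> fx; apply: contraNT fx => xb; apply/eqP; apply: big1 => k _.
    suff -> : basis R spin (m k) x = 0 by rewrite mulr0.
    by apply/eqP; apply: contraNT xb; exact: basis_in_box.
  have f0_gt0 : 0 < ip f0 f0.
    rewrite f0c (bigD1 k0) //= ltr_pwDl ?exprn_even_gt0 //.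
    by apply: sumr_ge0 => k _; exact: sqr_ge0.
  have [h1 h2 _] := localize_K f0_box.
  have fE : f = fun x => chi x * f0 x.
    by apply/funext => x; rewrite /f /f0 mulr_sumr; apply: eq_bigr => k _; rewrite /w; ring.
  rewrite fE; set F := ip f0 f0 in f0E f0_gt0 h1 h2 *.
  set FC := ip _ _ in h2 *; set FA := form (kinetic_A L) _ _ _ in h1 *.
  have e1 : 0 < eps := eps_gt0.
  have FC_ge : (1 - eps - eps * e) * F <= FC.
    apply: le_trans h2; rewrite [_ * F]mulrBl lerD2l lerN2 -mulrA ler_pM2l //.
  split; first by apply: lt_le_trans FC_ge; exact: mulr_gt0.
  apply: (@le_trans _ _ (E * ((1 - eps - eps * e) * F))); last by rewrite ler_wpM2l.
  rewrite mulrA; apply: (@le_trans _ _ (((1 + eps) ^+ 2 * e + 2 * eps) * F)).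
    apply: (le_trans h1); rewrite [leRHS]mulrDl lerD2r -mulrA ler_pM2l //.
    by rewrite exprn_gt0 // ltr_wpDl.
  by rewrite ler_pM2r.
exists (fun k => g k), (fun k => mu k); split=> [k|b b0 k]; first exact: gE.
have lg (j : 'I_n.+1) : l2 (g j) by have [[[]]] := gE _ (ltn_ord j).
have : ip (fun x => \sum_(j < n.+1) b j * g j x) (g k) = b k.
  rewrite (ip_suml _ b (g := fun j : 'I_n.+1 => g j)) // (bigD1 k) //= gorth // eqxx mulr1.
  rewrite big1 ?addr0 // => j jk; rewrite gorth // (_ : (_ == _) = false) ?mulr0 //.
  exact/negbTE.
move=> <-; rewrite /ip (_ : (fun x => _) = fun=> 0) ?Sum0 //.
by apply/funext => x; rewrite b0 mul0r.
Qed.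
End Comparison.

(** * Counting harmonic levels, scaling, and passage to the limit *)

Section HarmonicLevels.
Variables (R : realType) (d : nat) (omega : 'I_d -> R).
Hypothesis omega_gt0 : forall i, 0 < omega i.
Hypothesis d_gt0 : (0 < d)%N.

Lemma harm_level_gt0 m : 0 < harm_level omega m.
Proof.
rewrite /harm_level mulr_gt0 ?invr_gt0 // (bigD1 (Ordinal d_gt0)) //= ltr_pwDl //.
  by rewrite mulr_gt0 // ltr_wpDl // mulr_ge0.
by apply: sumr_ge0 => i _; rewrite mulr_ge0 ?(ltW (omega_gt0 i)) // addr_ge0 // mulr_ge0.
Qed.

Variable n : nat.

Let level_set := [set E : R | exists m : 'I_n.+1 -> {ffun 'I_d -> nat},
  injective m /\ forall k, harm_level omega (m k) <= E].

Let level_set_lb : lbound level_set 0.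
Proof.
by move=> E [m [_ /(_ ord0)]]; apply: le_trans; exact/ltW/harm_level_gt0.
Qed.

Let level_set_neq0 : level_set !=set0.
Proof.
pose m (k : 'I_n.+1) : {ffun 'I_d -> nat} := [ffun=> k : nat].
exists (\sum_k harm_level omega (m k)), m; split=> [k l|k].
  by move/ffunP/(_ (Ordinal d_gt0)); rewrite !ffunE => /val_inj.
rewrite (bigD1 k) //= lerDl; apply: sumr_ge0 => j _; exact/ltW/harm_level_gt0.
Qed.

Lemma e_harm_ge0 : 0 <= e_harm omega n.
Proof. exact: lb_le_inf. Qed.

Lemma e_harm_near e : 0 < e -> exists m : 'I_n.+1 -> {ffun 'I_d -> nat},
  injective m /\ forall k, harm_level omega (m k) <= e_harm omega n + e.
Proof.
move=> e0; have hi : has_inf level_set by split=> //; exists 0.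
have [E [m [m_inj mE]] Ee] := inf_adherent e0 hi.
by exists m; split=> // k; apply: (le_trans (mE k)); exact: ltW.
Qed.

(** Finitely many levels below [e_harm] have a maximum still below it; n + 1 of them would put that
    maximum in the set whose infimum is [e_harm]. *)
Lemma card_level_lt_e_harm (K : nat) :
  (#|[pred m : {ffun 'I_d -> 'I_K} | (harm_level omega (multi m) < e_harm omega n)%R]|
     <= n)%N.
Proof.
set A := [pred m | _]; rewrite leqNgt; apply/negP => nA.
pose m (k : 'I_n.+1) := multi (enum_val (widen_ord nA k)).
have mA k : harm_level omega (m k) < e_harm omega n by exact: (enum_valP (widen_ord nA k)).
pose E := \big[Num.max/0]_k harm_level omega (m k).
have Ee : E < e_harm omega n.
  apply/bigmax_ltP; split=> [|k _]; last exact: mA.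
  by apply: lt_trans (mA ord0); exact: harm_level_gt0.
suff : e_harm omega n <= E by rewrite leNgt Ee.
apply: ge_inf; first by exists 0.
exists m; split=> [k l /ffunP mkl|k]; last exact: le_bigmax.
have /enum_val_inj : enum_val (widen_ord nA k) = enum_val (widen_ord nA l).
  by apply/ffunP => i; apply: val_inj; have := mkl i; rewrite !ffunE.
by move/(congr1 val) => /= ?; exact: val_inj.
Qed.
End HarmonicLevels.

(** With [a = N^(1-gamma)] and [L = N^(1+gamma)] one has [N^2 = a L] and [N^(2(1-gamma)) = a^2]. *)
Lemma HN_fop (R : realType) (d : nat) (omega : 'I_d -> R) (gamma : R) (N : nat)
    (f : site d -> R) (x : site d) : (0 < N)%N ->
  HN omega gamma N f x = powR N%:R (1 - gamma) *
    fop (kinetic_A (powR N%:R (1 + gamma))) (potential_A omega (powR N%:R (1 + gamma))) f x.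
Proof.
move=> N0; have r0 : 0 < N%:R :> R by rewrite ltr0n.
set r := N%:R in r0 *; set a := powR r (1 - gamma); set L := powR r (1 + gamma).
have a0 : 0 < a by exact: powR_gt0.
have L0 : 0 < L by exact: powR_gt0.
have aL : r ^+ 2 = a * L.
  rewrite /a /L -powRD; last by rewrite (lt0r_neq0 r0) implybT.
  by rewrite -powR_mulrn ?ltW //; congr powR; ring.
have aa : powR r (2 * (1 - gamma)) = a ^+ 2.
  by rewrite mulr_natl mulr2n powRD ?expr2 // (lt0r_neq0 r0) implybT.
rewrite /HN /Vharm -/r aa aL /fop mulrDr; congr (_ + _).
  rewrite /nbsum !mulr_sumr; apply: eq_bigr => i _.
  by rewrite /kinetic_A; ring.
rewrite /potential_A mulrA; congr (_ * _); rewrite !mulr_sumr; apply: eq_bigr => i _.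
rewrite expr_div_n aL; field.
by rewrite !lt0r_neq0.
Qed.

Section Thresholds.
Variables (R : realType) (d : nat) (Omega kappa eps : R) (M : nat).
Hypotheses (d_gt0 : (0 < d)%N) (Omega_gt0 : 0 < Omega) (kappa_gt0 : 0 < kappa).
Hypothesis eps_gt0 : 0 < eps.

Lemma comparison_threshold : exists2 L0 : R, 0 < L0 & forall L, L0 <= L ->
  [/\ Omega <= 2 * (eps / 10) * L,
      L * (1 + eps^-1) * (eps / 10 / Omega * L)^-1 ^+ 2 <= eps / d%:R,
      Omega ^+ 2 <= eps / d%:R * L,
      d%:R / (eps * (eps / 10 / Omega * L) ^+ 2) <= eps / 2 * (kappa ^+ 2 / (2 * L)) &
      M.+1%:R * Omega <= L].
Proof.
have dR : 0 < d%:R :> R by rewrite ltr0n.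
have e10 : 0 < 2 * (eps / 10) by rewrite mulr_gt0 // divr_gt0.
have ed : 0 < eps / d%:R by rewrite divr_gt0.
set D := eps / 10 / Omega; have D0 : 0 < D by rewrite !divr_gt0.
have D2 : 0 < D ^+ 2 by rewrite exprn_gt0.
have A0 : 0 < 1 + eps^-1 by rewrite ltr_wpDl // invr_gt0.
have k2 : 0 < eps ^+ 2 * kappa ^+ 2 * D ^+ 2.
  by apply: mulr_gt0 => //; apply: mulr_gt0; exact: exprn_gt0.
(* Each condition becomes a lower bound on L after clearing denominators. The sum of the nonnegative
   thresholds dominates each of them. *)
pose t1 := Omega / (2 * (eps / 10)); pose t2 := (1 + eps^-1) / (eps / d%:R * D ^+ 2).
pose t3 := Omega ^+ 2 / (eps / d%:R); pose t4 := 4 * d%:R / (eps ^+ 2 * kappa ^+ 2 * D ^+ 2).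
pose t5 := M.+1%:R * Omega.
have t10 : 0 <= t1 by rewrite divr_ge0 // ltW.
have t20 : 0 <= t2 by apply: divr_ge0; apply: ltW => //; exact: mulr_gt0.
have t30 : 0 <= t3 by rewrite divr_ge0 ?sqr_ge0 // ltW.
have t40 : 0 <= t4 by apply: divr_ge0; [exact: mulr_ge0|exact: ltW].
have t50 : 0 < t5 by rewrite mulr_gt0.
exists (t1 + t2 + t3 + t4 + t5); first by lra.
move=> L LL; have L0 : 0 < L by lra.
have L1 : t1 <= L by lra.
have L2 : t2 <= L by lra.
have L3 : t3 <= L by lra.
have L4 : t4 <= L by lra.
have L5 : t5 <= L by lra.
split; last exact: L5.
- by rewrite mulrC -ler_pdivrMr.
- rewrite (_ : L * _ * _ = (1 + eps^-1) / (D ^+ 2 * L)); last first.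
    by field; rewrite !lt0r_neq0.
  rewrite ler_pdivrMr; last exact: mulr_gt0.
  by rewrite mulrA mulrC -ler_pdivrMr // mulr_gt0.
- by rewrite mulrC -ler_pdivrMr.
- rewrite ler_pdivrMr; last by rewrite mulr_gt0 // exprn_gt0 // mulr_gt0.
  rewrite (_ : eps / 2 * _ * _ = L * (eps ^+ 2 * kappa ^+ 2 * D ^+ 2) / 4); last first.
    by field; rewrite lt0r_neq0.
  by rewrite ler_pdivlMr // [d%:R * 4]mulrC -ler_pdivrMr.
Qed.
End Thresholds.

Section Asymptotics.
Variables (R : realType) (d : nat) (omega : 'I_d -> R).
Hypothesis omega_gt0 : forall i, 0 < omega i.
Hypothesis d_gt0 : (0 < d)%N.
Variable n : nat.
Let e := e_harm omega n.

Lemma oscillator_eigenvalue_bounds tau : 0 < tau -> exists2 L0 : R, 0 < L0 &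
  forall L, L0 <= L ->
  (forall (g : 'I_n.+1 -> site d -> R) (mu : 'I_n.+1 -> R) E,
     (forall k, weak_eigfun (kinetic_A L) (potential_A omega L) (mu k) (g k)) ->
     (forall k, mu k <= E) -> linindep g -> e - tau <= E) /\
  exists (g : 'I_n.+1 -> site d -> R) (mu : 'I_n.+1 -> R),
    (forall k, weak_eigfun (kinetic_A L) (potential_A omega L) (mu k) (g k) /\
      mu k <= e + tau) /\ linindep g.
Proof.
move=> tau0; have e0 : 0 <= e by exact: e_harm_ge0.
pose i0 := Ordinal d_gt0.
(* Closed-form bounds on all frequencies, without selecting a largest or a smallest one. *)
pose Omega := \sum_i omega i; pose kappa := (\sum_i (omega i)^-1)^-1.
have le_Omega i : omega i <= Omega.
  by rewrite /Omega (bigD1 i) //= lerDl; apply: sumr_ge0 => j _; exact: ltW.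
have Omega_gt0 : 0 < Omega by exact: lt_le_trans (le_Omega i0).
have sum_inv i : (omega i)^-1 <= \sum_j (omega j)^-1.
  rewrite (bigD1 i) //= lerDl; apply: sumr_ge0 => j _.
  by rewrite invr_ge0; exact: ltW.
have kappa_gt0 : 0 < kappa.
  by rewrite invr_gt0; apply: lt_le_trans (sum_inv i0); rewrite invr_gt0.
have kappa_le i : kappa <= omega i.
  rewrite /kappa -[leRHS]invrK lef_pV2 ?posrE ?invr_gt0 //.
  by apply: lt_le_trans (sum_inv i); rewrite invr_gt0.
(* The first bracket is the coefficient of eps lost in the lower bound; the other two terms are the
   loss in the upper bound. *)
pose B := (e ^+ 2 + 4 * e + 2) + (3 * e + 6) + (e + tau) * (e + 2).
have B0 : 0 < B.
  have := mulr_ge0 e0 e0; have := mulr_ge0 (ltW tau0) e0; rewrite /B; nra.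
pose eps := Num.min 1 (tau / B).
have eps_gt0 : 0 < eps by rewrite lt_min ltr01 divr_gt0.
have eps_le1 : eps <= 1 by rewrite ge_min lexx.
have eps_B : eps * B <= tau by rewrite -ler_pdivlMr // ge_min lexx orbT.
(* Approximating the infimum suffices: the upper bound is run with [e + eps] in place of [e]. The
   total [M] of all entries, once below every spin, makes these indices admissible for K. *)
have [m [m_inj me]] := e_harm_near omega_gt0 d_gt0 n eps_gt0.
pose M := (\sum_k \sum_i m k i)%N.
have [L0 L0_gt0 L0P] := comparison_threshold M d_gt0 Omega_gt0 kappa_gt0 eps_gt0.
exists L0 => // L LL; have L_gt0 : 0 < L by exact: lt_le_trans LL.
have [c1 c2 c3 c4 c5] := L0P L LL.
have spin_ge i : (M <= spin omega L i)%N.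
  have /andP[_ h] := spin_itv kappa_gt0 kappa_le L_gt0 i.
  rewrite -ltnS -(ltr_nat R) -natr1; apply: le_lt_trans h.
  rewrite ler_pdivlMr //; apply: le_trans c5.
  by apply: ler_pM; rewrite ?ler_nat ?(ltW (omega_gt0 i)).
split=> [g mu E gE muE gfree|].
  have [Ee|/ltW eE] := lerP E e; last by lra.
  have spin_lt i : ((spin omega L i).*2 < (\sum_j spin omega L j).*2.+1)%N.
    by rewrite ltnS leq_double (bigD1 i) //= leq_addr.
  have := eigenvalue_lower_bound d_gt0 kappa_gt0 kappa_le le_Omega Omega_gt0 eps_gt0 eps_le1
    L_gt0 c1 c2 c3 c4 spin_lt (card_level_lt_e_harm omega_gt0 d_gt0 n _) gE muE gfree e0 Ee.
  have h1 : (1 + eps) ^+ 2 * E <= E + 3 * eps * e.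
    have : 2 * eps + eps ^+ 2 <= 3 * eps by nra.
    have : 0 <= 2 * eps + eps ^+ 2 by nra.
    nra.
  have h2 : eps * (e ^+ 2 + 4 * e + 2) <= tau.
    apply: le_trans eps_B; rewrite ler_pM2l // /B.
    by have := mulr_ge0 (ltW tau0) e0; nra.
  rewrite -/e; nra.
have h1 : eps * ((3 * e + 6) + (e + tau) * (e + 2)) <= tau.
  by apply: le_trans eps_B; rewrite ler_pM2l // /B; nra.
have h2 : (1 + eps) ^+ 2 * (e + eps) + 2 * eps <= (e + tau) * (1 - eps - eps * (e + eps)).
  have eps2 : eps ^+ 2 <= eps by rewrite expr2 -[leRHS]mulr1 ler_pM2l.
  have sqr_le : (1 + eps) ^+ 2 * (e + eps) <= (1 + 3 * eps) * (e + eps).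
    by rewrite ler_wpM2r ?addr_ge0 ?(ltW eps_gt0) //; lra.
  have small_le : (e + tau) * (eps * (e + 2)) >= (e + tau) * (eps + eps * (e + eps)).
    rewrite ler_wpM2l ?addr_ge0 ?(ltW tau0) // -{1}[eps]mulr1 -mulrDr ler_pM2l //; lra.
  by move: sqr_le small_le h1 eps2; lra.
apply: (eigenvalue_upper_bound d_gt0 kappa_gt0 kappa_le le_Omega Omega_gt0 eps_gt0 eps_le1
    L_gt0 c1 c2 c4 m_inj _ me _ _ h2).
- move=> k i; apply: (@leq_trans M); last by rewrite (leq_trans (spin_ge i)) // -addnn leq_addr.
  rewrite /M (bigD1 k) //= (bigD1 i) //= -addnA; exact: leq_addr.
- have : 0 < (1 + eps) ^+ 2 * (e + eps) + 2 * eps.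
    apply: ltr_wpDl; last exact: mulr_gt0.
    by apply: mulr_ge0; [exact: sqr_ge0|rewrite addr_ge0 // ltW].
  by move=> /lt_le_trans/(_ h2); rewrite pmulr_rgt0 // ltr_wpDl.
- by rewrite addr_ge0 // ltW.
Qed.
End Asymptotics.

Lemma is_l2P (R : realType) (d : nat) (f : site d -> R) : is_l2 f <-> l2 f.
Proof.
rewrite /is_l2 /l2 /l1 [X in _ <-> is_true (X < _)%E](@eq_esum _ _ _ _
  (fun x => (f x ^+ 2)%:E)) // => x _.
by rewrite ger0_norm ?sqr_ge0.
Qed.

Theorem theorem2p1 (R : realType) (d : nat) (omega : 'I_d -> R) (gamma : R) :
  (1 <= d)%N -> (forall i, 0 < omega i) -> -1 < gamma ->
  forall n : nat,
    (fun N : nat => Eval (HN omega gamma N) n / powR N%:R (1 - gamma))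
      @ \oo --> e_harm omega n.
Proof.
move=> d_gt0 omega_gt0 gamma_gt n; apply/cvgrPdist_le => tau tau0.
have [L0 L0_gt0 L0P] := oscillator_eigenvalue_bounds omega_gt0 d_gt0 n tau0.
have g1 : 0 < 1 + gamma by lra.
near=> N.
have N0 : (0 < N)%N by near: N; exact: nbhs_infty_gt.
have r0 : 0 < N%:R :> R by rewrite ltr0n.
pose L := powR N%:R (1 + gamma) : R; pose a := powR N%:R (1 - gamma) : R.
have a0 : 0 < a by exact: powR_gt0.
have L_gt0 : 0 < L by exact: powR_gt0.
have LL : L0 <= L.
  (* Here [gamma > -1] enters: L exceeds [L0] as soon as N exceeds [L0^(1/(1+gamma))]. *)
  have -> : L0 = powR (powR L0 (1 + gamma)^-1) (1 + gamma).
    by rewrite -powRrM mulVf ?lt0r_neq0 // powRr1 // ltW.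
  apply: ge0_ler_powR; rewrite ?nnegrE ?powR_ge0 ?(ltW g1) //.
  by near: N; exact: nbhs_infty_ger.
have [lower [g [mu [gE gfree]]]] := L0P L LL.
have kinetic_ge0 (i : 'I_d) (x : site d) : 0 <= kinetic_A L i x by rewrite divr_ge0 // ltW.
have W_ge0 x : 0 <= potential_A omega L x.
  apply: sumr_ge0 => i _; apply: divr_ge0; first by apply: mulr_ge0; exact: sqr_ge0.
  by rewrite mulr_ge0 // ltW.
set S := [set E : R | exists (g : 'I_n.+1 -> site d -> R) (mu : 'I_n.+1 -> R),
   (forall k, is_eigfun (HN omega gamma N) (mu k) (g k) /\ mu k <= E) /\ linindep g].
have S_lb E : S E -> (e_harm omega n - tau) * a <= E.
  move=> [h [nu [hE hfree]]]; rewrite -ler_pdivlMr //.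
  apply: (lower h (fun k => nu k / a)) => // k; last first.
    by rewrite ler_pM2r ?invr_gt0 //; case: (hE k).
  have [[lh _ hk] _] := hE k.
  apply: (@fop_weak_eigfun _ _ _ _ (L / 2)) => //.
  - exact: (proj1 (is_l2P _) lh).
  - move=> x; have := hk x; rewrite HN_fop // -/a -/L => e.
    by rewrite -[LHS](mulKf (lt0r_neq0 a0)) e mulrCA mulrA.
(* Besides the upper bound, this shows that [S] is nonempty, which the lower bound on [inf S]
   requires. *)
have S_mem : S ((e_harm omega n + tau) * a).
  exists g, (fun k => a * mu k); split=> // k; have [gk muk] := gE k.
  split; last by rewrite mulrC ler_pM2r.
  have [[lg _] _] := gk; split.
  - exact: (proj2 (is_l2P _) lg).
  - apply: contrapT => g0; have g00 x : g k x = 0.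
      by apply: contrapT => /eqP gx; apply: g0; exists x.
    (* A zero member would give a linear relation with the k-th unit vector as coefficients. *)
    have : (k == k)%:R = 0 :> R.
      apply: (gfree (fun j => (j == k)%:R)) => x; rewrite big1 // => j _.
      by case: eqP => [->|_]; rewrite ?g00 ?mulr0 ?mul0r.
    by rewrite eqxx; apply/eqP; rewrite oner_eq0.
  - move=> x; rewrite HN_fop // -/a -/L.
    by rewrite (weak_eigfun_fop kinetic_ge0 (C := L / 2) _ W_ge0 gk) ?mulrA.
have S_ge : (e_harm omega n - tau) * a <= inf S.
  by apply: lb_le_inf => //; exists ((e_harm omega n + tau) * a).
have S_le : inf S <= (e_harm omega n + tau) * a.
  by apply: ge_inf => //; exists ((e_harm omega n - tau) * a).
rewrite -/a /Eval -/S ler_distlC.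
by rewrite ler_pdivlMr // ler_pdivrMr // S_ge.
Unshelve. all: by end_near. Qed.
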